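(* Let $G$ be a group of automorphisms of a vertex operator algebra $V$, $z\in\mathbb C^\times$, let $\mathcal C$ be a category of twisted modules satisfying the Assumption in the context, and let $W_1,W_2$ be $g_1$-, $g_2$-twisted $V$-modules in $\mathcal C$, $g_1,g_2\in G$. Let $W_1\boxtimes_{P(z)}W_2=(W_1\square_{P(z)}W_2)'$ and let $\boxtimes_{P(z)}:W_1\otimes W_2\to\overline{W_1\boxtimes_{P(z)}W_2}=(W_1\square_{P(z)}W_2)^*$ be the twisted $P(z)$-intertwining map given by $$\langle\lambda,\ w_1\boxtimes_{P(z)}w_2\rangle=\lambda(w_1\otimes w_2),\qquad \lambda\in W_1\square_{P(z)}W_2,\ w_1\in W_1,\ w_2\in W_2 .$$ Then the pair $(W_1\boxtimes_{P(z)}W_2,\boxtimes_{P(z)})$ is a $P(z)$-tensor product of $W_1$ and $W_2$ in $\mathcal C$.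
   Context: **Notation.** $V$ is a vertex operator algebra over $\mathbb C$ with vertex operator map $Y_V$, vacuum $\mathbf 1$, conformal element $\omega$ and Virasoro operators $L_V(n)$. $\mathbb N=\{0,1,\dots\}$, $\mathbb Z_+=\{1,2,\dots\}$. For $z\in\mathbb C^\times$, $p\in\mathbb Z$: $l_p(z)=\log|z|+\mathrm i\arg z+2\pi p\,\mathrm i$ with $0\le\arg z<2\pi$, and $\log z=l_0(z)$. $U\{x\}$ is the space of formal series in complex powers of $x$ with coefficients in $U$. For $f(x)=\sum_{k=0}^K\sum_{n\in\mathbb C}a_{n,k}x^n(\log x)^k$ the $p$-th analytic branch is $f^p(z)=\sum_{k}\sum_n a_{n,k}e^{nl_p(z)}l_p(z)^k$, and $f(z)$ means $f^0(z)$. For $W=\coprod_{n\in\mathbb C}W_{[n]}$: $W'=\coprod_n W_{[n]}^*$, $\overline W=\prod_nW_{[n]}$, and $\pi_n$ is the projection to $W_{[n]}$. Matrix coefficients of products (resp. iterates) of operators at complex numbers are the series obtained by inserting $\pi_n$, summed over $n\in\mathbb C$, between consecutive operators (resp. in front of the inner operator). **Twisted modules.** Let $g$ be an automorphism of $V$. A generalized $g$-twisted $V$-module without a $g$-action is a $\mathbb C$-graded space $W=\coprod_{n\in\mathbb C}W_{[n]}$ with a linear map $Y_W^g:V\otimes W\to W\{x\}[\log x]$, $Y_W^g(v,x)w=\sum_{k=0}^K\sum_{n\in\mathbb C}(Y_W^g)_{n,k}(v)w\,x^{-n-1}(\log x)^k$, such that: (i) $(Y_W^g)^{p+1}(gv,z)w=(Y_W^g)^p(v,z)w$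 for $p\in\mathbb Z$, $z\in\mathbb C^\times$; (ii) $Y_W^g(\mathbf 1,x)w=w$; (iii) (duality) for $u,v\in V$, $w\in W$, $w'\in W'$ there is a multivalued analytic function $f(z_1,z_2)=\sum_{i,j,k,l=0}^Na_{ijkl}z_1^{m_i}z_2^{n_j}(\log z_1)^k(\log z_2)^l(z_1-z_2)^{-t}$ ($m_i,n_j\in\mathbb C$, $t\in\mathbb Z_+$) such that for $p\in\mathbb Z$ the series $\langle w',(Y_W^g)^p(u,z_1)(Y_W^g)^p(v,z_2)w\rangle$, $\langle w',(Y_W^g)^p(v,z_2)(Y_W^g)^p(u,z_1)w\rangle$, $\langle w',(Y_W^g)^p(Y_V(u,z_1-z_2)v,z_2)w\rangle$ are absolutely convergent on $|z_1|>|z_2|>0$, $|z_2|>|z_1|>0$, $|z_2|>|z_1-z_2|>0$, respectively, with sums equal to the branch $\sum a_{ijkl}e^{m_il_p(z_1)}e^{n_jl_p(z_2)}l_p(z_1)^kl_p(z_2)^l(z_1-z_2)^{-t}$ on $|z_1|>|z_2|>0$, on $|z_2|>|z_1|>0$, and on $|z_2|>|z_1-z_2|>0$, $|\arg z_1-\arg z_2|<\frac\pi2$, respectively; (iv) with $L(n)=\mathrm{Res}_x x^{n+1}Y_W^g(\omega,x)$, for each $w\in W_{[n]}$ there is $K\in\mathbb Z_+$ with $(L(0)-n)^Kw=0$; (v) $\frac{d}{dx}Y_W^g(v,x)=Y_W^g(L_V(-1)v,x)$. It is lower bounded if for each $n\in\mathbb C$, $W_{[n+l]}=0$ for sufficiently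 negative real $l$; grading-restricted if moreover all $\dim W_{[n]}<\infty$. It is ''with a $g$-action'' if in addition $W=\coprod_{n\in\mathbb C,\alpha\in\mathbb C/\mathbb Z}W_{[n]}^{[\alpha]}$, $g$ acts on $W$, there is $\Lambda\in\mathbb Z_+$ with $(g-e^{2\pi\alpha\mathrm i})^\Lambda w=0$ for $w\in W^{[\alpha]}=\coprod_nW^{[\alpha]}_{[n]}$, and $gY_W^g(u,x)w=Y_W^g(gu,x)gw$. ''$g$-twisted $V$-module'' means lower-bounded generalized $g$-twisted $V$-module, with or without a $g$-action. The contragredient of $W$ is the $g^{-1}$-twisted $V$-module $W'$ with $\langle(Y_W^g)'(v,x)w',w\rangle=\langle w',Y_W^g(e^{xL(1)}(-x^{-2})^{L(0)}v,x^{-1})w\rangle$; write $Y_{W'}^{g^{-1}}=(Y_W^g)'$. **Branches.** $M^n=\{(z_1,\dots,z_n)\in\mathbb C^n: z_i\ne0,\ z_i\neq z_j\ (i\ne j)\}$. $M^2_0$ is the simply connected region obtained by cutting $M^2$ along $z_1\in\mathbb R_+$, $z_2\in\mathbb R_+$, $z_1-z_2\in\mathbb R_+$, with the cuts attached to the upper half $z_1$-, $z_2$-, $(z_1-z_2)$-planes. **Regular singularities.** Let $\delta\in\{0,\infty\}^n$. For $r\in\mathbb R_+^n$ let $\Delta^\times(\delta,r)$ be the set of $z\in\mathbb C^n$ with $|z_i|>r_i$ if $\delta_i=\infty$ and $0<|z_i|<r_i$ if $\delta_i=0$. A multivalued analytic $f$ on an open region $\Omega\subset\mathbb C^n$ has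 a component-isolated singularity at $(z_1,\dots,z_n)=\delta$ if $\Delta^\times(\delta,r)\subset\Omega$ for some $r$; it is regular if there are $K\in\mathbb N$ and $D_i=\bigcup_{j=1}^{N_i}(r^{(i)}_j+\mathbb N)$ (if $\delta_i=0$) or $\bigcup_{j=1}^{N_i}(r^{(i)}_j-\mathbb N)$ (if $\delta_i=\infty$), $r_j^{(i)}\in\mathbb C$, such that every single-valued branch of $f$ near $\delta$ (cuts along $z_i\in\mathbb R_+$) equals on some $\Delta^\times(\delta,r)$ an absolutely convergent series $\sum_{a_i\in D_i}\sum_{j_1,\dots,j_n=0}^K\alpha_{a_1,j_1;\dots;a_n,j_n}z_1^{a_1}(\log z_1)^{j_1}\cdots z_n^{a_n}(\log z_n)^{j_n}$. For $\beta\in\mathbb C^n$, $(z_1,\dots,z_n)-\beta=\delta$ is a component-isolated (regular) singularity of $f$ if $\zeta=\delta$ is one of $\zeta\mapsto f(\zeta+\beta)$. **Twisted intertwining operators.** Let $W_1,W_2,W_3$ be $g_1$-, $g_2$-, $g_3$-twisted $V$-modules. A twisted intertwining operator of type $\binom{W_3}{W_1W_2}$ is a linear map $\mathcal Y:W_1\otimes W_2\to W_3\{x\}[\log x]$, $\mathcal Y(w_1,x)w_2=\sum_{k=0}^K\sum_{n\in\mathbb C}\mathcal Y_{n,k}(w_1)w_2x^{-n-1}(\log x)^k$, such that: (1) for $w_1,w_2,n,k$, $\mathcal Y_{n+l,k}(w_1)w_2=0$ for $l\in\mathbb N$ large; (2) (duality) for $u\in V$, $w_i\in W_i$, $w_3'\in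 W_3'$ there is a maximally extended multivalued analytic function on $M^2$ with a preferred single-valued branch $f^e(z_1,z_2)$ on $M_0^2$ such that $\langle w_3',Y_{W_3}^{g_3}(u,z_1)\mathcal Y(w_1,z_2)w_2\rangle$, $\langle w_3',\mathcal Y(w_1,z_2)Y_{W_2}^{g_2}(u,z_1)w_2\rangle$, $\langle w_3',\mathcal Y(Y_{W_1}^{g_1}(u,z_1-z_2)w_1,z_2)w_2\rangle$ are absolutely convergent on $|z_1|>|z_2|>0$, $|z_2|>|z_1|>0$, $|z_2|>|z_1-z_2|>0$, respectively, with sums equal to $f^e(z_1,z_2)$ on $|z_1|>|z_2|>0$, $|\arg(z_1-z_2)-\arg z_1|<\frac\pi2$; on $|z_2|>|z_1|>0$, $-\frac{3\pi}2<\arg(z_1-z_2)-\arg z_2<-\frac\pi2$; and on $|z_2|>|z_1-z_2|>0$, $|\arg z_1-\arg z_2|<\frac\pi2$, respectively; (3) for $k\ge3$, $u_1,\dots,u_{k-1}\in V$, $w_i\in W_i$, $w_3'\in W_3'$, the series $\langle w_3',Y_{W_3}^{g_3}(u_1,z_1)\cdots Y_{W_3}^{g_3}(u_{k-1},z_{k-1})\mathcal Y(w_1,z_k)w_2\rangle$ is absolutely convergent on $|z_1|>\cdots>|z_k|>0$ and can be maximally extended to a multivalued analytic function $f(z_1,\dots,z_k)$ on $M^k$; moreover, for fixed $z_k\in\mathbb C^\times$ and $M_{ij}\in\mathbb Z_+$ with $x^{M_{ij}}Y_V(u_i,x)u_j\in V[[x]]$, any component-isolated singularity of the form $(z_1,\dots,z_{k-1})-\beta=\delta$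 ($\beta\in\mathbb C^{k-1}$, $\delta\in\{0,\infty\}^{k-1}$) of the multivalued function of $z_1,\dots,z_{k-1}$ obtained as a value at $\zeta=z_k$ of $\prod_{1\le i<j\le k-1}(z_i-z_j)^{M_{ij}}f(z_1,\dots,z_{k-1},\zeta)$ is regular; (4) $\frac d{dx}\mathcal Y(w_1,x)=\mathcal Y(L(-1)w_1,x)$. **Category and $\square_{P(z)}$.** $\mathcal C$ is either a category $\mathcal C_1$ of $g$-twisted $V$-modules without $g$-actions, $g\in G$, or a category $\mathcal C_2$ of $g$-twisted $V$-modules with $G$-actions, $g\in G$ (i.e. with a $g$-action extended to a left $G$-module structure, with no further conditions on the other elements of $G$). Morphisms are $V$-module maps (linear maps commuting with twisted vertex operators, not required to commute with $G$); the only morphism between a $g$- and an $h$-twisted module with $g\ne h$ is $0$. For $W_1,W_2,W_3\in\mathcal C$ that are $g_1$-, $g_2$-, $g_1g_2$-twisted, a twisted $P(z)$-intertwining map of type $\binom{W_3}{W_1W_2}$ is a linear map $I:W_1\otimes W_2\to\overline{W_3}$ of the form $I(w_1\otimes w_2)=\mathcal Y(w_1,z)w_2$ with $\mathcal Y$ a twisted intertwining operator of that type; then $(W_3,I)$ is called a $P(z)$-product of $W_1$ and $W_2$. For $w_3'\in W_3'$ let $\lambda_{I,w_3'}\in(W_1\otimes W_2)^*$, $\lambda_{I,w_3'}(w_1\otimes w_2)=\langle w_3',I(w_1\otimes w_2)\rangle$. $W_1\square_{P(z)}W_2\subset(W_1\otimes W_2)^*$ is the span of all $\lambda_{I,w_3'}$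 for all $P(z)$-products $(W_3,I)$ in $\mathcal C$ and $w_3'\in W_3'$, with the (well-defined) vertex operator map $Y^{(g_1g_2)^{-1}}_{W_1\square_{P(z)}W_2}(v,x)\lambda_{I,w_3'}=\lambda_{I,\,Y_{W_3'}^{(g_1g_2)^{-1}}(v,x)w_3'}$, and graded by the images of the weight spaces $(W_3')_{[n]}$; it is a generalized $(g_1g_2)^{-1}$-twisted $V$-module. **Assumption.** (1) For $W_1,W_2\in\mathcal C$ the contragredient of $W_1\square_{P(z)}W_2$ is also in $\mathcal C$ (for $\mathcal C=\mathcal C_2$ this means there is a $G$-action on $W_1\square_{P(z)}W_2$ and a decomposition into generalized eigenspaces of the $g_1g_2$-action such that its contragredient with this structure is an object of $\mathcal C_2$). (2) The double contragredient of an object of $\mathcal C$ is equivalent to the object itself. **$P(z)$-tensor product.** A $P(z)$-tensor product of $W_1$ and $W_2$ in $\mathcal C$ is a $P(z)$-product $(T,\boxtimes)$ of $W_1$ and $W_2$ in $\mathcal C$ such that for every $P(z)$-product $(W_3,I)$ of $W_1$ and $W_2$ in $\mathcal C$ there is a unique module map $f:T\to W_3$ with $I=\bar f\circ\boxtimes$, where $\bar f:\overline T\to\overline{W_3}$ is the natural extension of $f$.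
   Formalization: That the map ⊠_{P(z)} given by the displayed formula is a twisted P(z)-intertwining map is taken as a hypothesis, as the ''let'' in the statement presupposes; it does not follow from the Assumption, since the powers of log x needed for a pair w_1, w_2 may be unbounded. *)

(* Defs.v *)
From HB Require Import structures.
From mathcomp Require Import all_boot all_order all_algebra.
From mathcomp Require Import complex finmap.
From mathcomp Require Import all_classical all_reals all_analysis.
From mathcomp Require Import ring.

Set Implicit Arguments.
Unset Strict Implicit.
Unset Printing Implicit Defensive.
Import Order.TTheory GRing.Theory Num.Theory.
Import numFieldNormedType.Exports.

Local Open Scope classical_set_scope.
Local Open Scope ring_scope.

(* An alias: on a [numClosedFieldType] the topology of the norm is canonical,
   which it is not on the type R[i] itself. *)
Definition Cx (R : realType) : numClosedFieldType := R[i]%C.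

Section ComplexAnalysis.
Variable R : realType.
Local Notation C := (Cx R).

Definition cRe (z : C) : R := complex.Re z.
Definition cIm (z : C) : R := complex.Im z.
Definition cabs (z : C) : R := cRe `|z|.
Definition ofR (x : R) : C := Complex x 0.

Definition expC (z : C) : C :=
  Complex (expR (cRe z) * cos (cIm z)) (expR (cRe z) * sin (cIm z)).

(* acos has values in [0, pi], so this lies in [0, 2 pi[. *)
Definition arg (z : C) : R :=
  if 0 <= cIm z then acos (cRe z / cabs z) else 2 * pi - acos (cRe z / cabs z).

Definition lp (p : int) (z : C) : C :=
  Complex (ln (cabs z)) (arg z + 2 * pi * p%:~R).

Definition abs_conv (I : choiceType) (c : I -> C) : Prop :=
  summable [set: I] (fun i => (cabs (c i))%:E).

Definition abs_sum (I : choiceType) (c : I -> C) (s : C) : Prop :=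
  abs_conv c /\
  forall e : R, 0 < e -> exists J0 : {fset I}, forall J : {fset I},
    (J0 `<=` J)%fset -> cabs (\sum_(i <- J) c i - s) < e.

Section Multivalued.
Variable n : nat.
Local Notation pt := 'rV[C]_n.

Definition analytic_at (f : pt -> C) (a : pt) : Prop :=
  exists c : {ffun 'I_n -> nat} -> C, nbhs a [set z : pt |
    abs_sum (fun e => c e * \prod_(i < n) (z 0 i - a 0 i) ^+ e i) (f z)].

Definition germ_eq (a : pt) (f h : pt -> C) : Prop :=
  \forall z \near a, f z = h z.

Definition path_in (Omega : set pt) (gamma : R -> pt) : Prop :=
  {within `[0, 1], continuous gamma} /\
  forall t, t \in `[0, 1]%R -> Omega (gamma t).

Definition continuation (gamma : R -> pt) (Phi : R -> pt -> C) : Prop :=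
  forall t, t \in `[0, 1]%R ->
    analytic_at (Phi t) (gamma t) /\
    exists2 e : R, 0 < e & forall s, s \in `[0, 1]%R -> `|s - t| < e ->
      germ_eq (gamma s) (Phi s) (Phi t).

Definition continuable (Omega : set pt) (a : pt) (f : pt -> C) : Prop :=
  forall gamma, path_in Omega gamma -> gamma 0 = a ->
    exists2 Phi, continuation gamma Phi & germ_eq a (Phi 0) f.

Definition continues_to (Omega : set pt) (a : pt) (f : pt -> C)
    (b : pt) (h : pt -> C) : Prop :=
  exists gamma Phi,
    [/\ path_in Omega gamma, gamma 0 = a, gamma 1 = b, continuation gamma Phi
      & germ_eq a (Phi 0) f /\ germ_eq b (Phi 1) h].

(* D is cut along the sets where one of the functions [cut j] is a positive
   real number, and a cut is attached to the region where [cut j] has a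
   nonnegative imaginary part: near a point [a] of a cut, [f] agrees with the
   germ [phi] on that side only.  In [C], [0 < x] means that x is real and
   positive. *)
Definition upper_agree (I : Type) (cut : I -> pt -> C) (D : set pt)
    (f phi : pt -> C) (a : pt) : Prop :=
  \forall z \near a, D z -> (forall j, 0 < cut j a -> 0 <= cIm (cut j z)) ->
    f z = phi z.

(* [f] is a single-valued branch, on the cut region D, of a multivalued
   analytic function on Omega. *)
Definition branch_of_multivalued (Omega : set pt) (I : Type)
    (cut : I -> pt -> C) (D : set pt) (f : pt -> C) : Prop :=
  forall a, D a -> exists phi,
    [/\ analytic_at phi a, upper_agree cut D f phi a & continuable Omega a phi].

Definition Mconf : set pt :=
  [set z : pt | (forall i, z 0 i != 0) /\ (forall i j, i != j -> z 0 i != z 0 j)].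

(* delta i = true stands for the i-th component being infinity, and
   delta i = false for its being 0. *)
Definition punctured (delta : 'I_n -> bool) (r : 'I_n -> R) : set pt :=
  [set z : pt | forall i, if delta i then r i < cabs (z 0 i)
                     else 0 < cabs (z 0 i) < r i].

Definition component_isolated (Omega : set pt) (beta : pt)
    (delta : 'I_n -> bool) : Prop :=
  exists2 r : 'I_n -> R, (forall i, 0 < r i) &
    forall zeta, punctured delta r zeta -> Omega (zeta + beta).

Definition exponent_in (infty : bool) (s : seq C) (a : C) : Prop :=
  exists2 r, r \in s &
    exists l : nat, a = if infty then r - l%:R else r + l%:R.

(* The multivalued function is given by its germ F at the point b. *)
Definition regular_singularity (Omega : set pt) (b : pt) (F : pt -> C)
    (beta : pt) (delta : 'I_n -> bool) : Prop :=
  exists (K : nat) (D : 'I_n -> seq C), forall (r : 'I_n -> R) (h : pt -> C),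
    let S := [set z | punctured delta r (z - beta)] in
    (forall i, 0 < r i) -> S `<=` Omega ->
    (forall a, S a -> exists2 phi,
       upper_agree (fun i z => z 0 i - beta 0 i) S h phi a &
       continues_to Omega b F a phi) ->
    exists (r' : 'I_n -> R)
           (alpha : {ffun 'I_n -> C} * {ffun 'I_n -> 'I_K.+1} -> C),
      [/\ forall i, 0 < r' i,
          forall aj, alpha aj != 0 ->
            forall i, exponent_in (delta i) (D i) (aj.1 i)
        & forall zeta, punctured delta r zeta -> punctured delta r' zeta ->
            abs_sum (fun aj => alpha aj *
                \prod_(i < n) (expC (aj.1 i * lp 0 (zeta 0 i)) *
                               lp 0 (zeta 0 i) ^+ aj.2 i))
              (h (zeta + beta))].

End Multivalued.

Definition pt2 (z1 z2 : C) : 'rV[C]_2 := \row_i (if i == 0 then z1 else z2).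

(* With [Mconf 2] as the domain, these cuts give M^2_0; [None] is the cut along
   the positive values of z_1 - z_2. *)
Definition cut2 (j : option 'I_2) (z : 'rV[C]_2) : C :=
  if j is Some i then z 0 i else z 0 0 - z 0 1.

End ComplexAnalysis.

Record submod (K : pzRingType) (E : lmodType K) := Submod {
  submod_pred :> E -> Prop;
  submod_pred0 : submod_pred 0;
  submod_predD : forall a u v,
    submod_pred u -> submod_pred v -> submod_pred (a *: u + v) }.

Section Submodule.
Variables (K : pzRingType) (E : lmodType K) (S : submod E).

Definition submod_mem : {pred E} := fun x => `[< S x >].

Lemma submod_mem_closed : submod_closed submod_mem.
Proof.
split; first exact/asboolP/submod_pred0.
by move=> a u v /asboolP Su /asboolP Sv; exact/asboolP/submod_predD.
Qed.

HB.instance Definition _ :=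
  GRing.isSubmodClosed.Build K E submod_mem
    (GRing.submod_closed_semi submod_mem_closed).

Record subspace := Subspace {
  subval : E;
  subvalP : subval \in submod_mem }.

HB.instance Definition _ := [isSub for subval].
HB.instance Definition _ := [Choice of subspace by <:].
HB.instance Definition _ := [SubChoice_isSubLmodule of subspace by <:].

Lemma subspaceP (x : subspace) : S (\val x).
Proof. by case: x => x /= /asboolP. Qed.

Lemma subspace_0E : \val (0 : subspace) = 0.
Proof. by []. Qed.

Lemma subspace_linE a (x y : subspace) :
  \val (a *: x + y) = a *: \val x + \val y.
Proof. by []. Qed.

Definition to_subspace (x : E) (Sx : S x) : subspace :=
  Subspace (asboolT Sx : x \in submod_mem).

End Submodule.

Section Span.
Variables (K : pzRingType) (E : lmodType K) (gen : E -> Prop).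

Inductive in_span : E -> Prop :=
| in_span0 : in_span 0
| in_spanD a x y : gen x -> in_span y -> in_span (a *: x + y).

Lemma in_span_linear a u v : in_span u -> in_span v -> in_span (a *: u + v).
Proof.
move=> su sv; elim: su => [|b x y gx _ IH]; first by rewrite scaler0 add0r.
by rewrite scalerDr scalerA -addrA; apply: in_spanD.
Qed.

Definition span : submod E := Submod in_span0 in_span_linear.

End Span.

(* A direct sum decomposition of W indexed by I, given by the projections onto
   the summands; the summand of index i is {w | prj i w = w}. *)
Definition is_grading (K : pzRingType) (I : choiceType) (W : lmodType K)
    (prj : I -> W -> W) : Prop :=
  [/\ forall i, linear (prj i),
      forall i j w, prj i (prj j w) = if i == j then prj i w else 0,
      forall w, finite_set [set i | prj i w != 0]
    & forall w, w = \sum_(i \in [set: I]) prj i w].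

Section GradedDual.
Variables (R : realType) (W : lmodType (Cx R)) (prj : Cx R -> W -> W).
Local Notation C := (Cx R).

Definition in_gdual (f : W -> C^o) : Prop :=
  scalar f /\ finite_set [set n | exists w, f (prj n w) != 0].

Lemma in_gdual0 : in_gdual 0.
Proof.
split; first by move=> a u v /=; rewrite /GRing.zero /= mulr0 addr0.
apply: (sub_finite_set (B := set0)); last exact: finite_set0.
by move=> n [w]; rewrite eqxx.
Qed.

Lemma in_gdualD a f h : in_gdual f -> in_gdual h -> in_gdual (a *: f + h).
Proof.
move=> [lf ff] [lh fh]; split.
  move=> b u v; rewrite !fctE /= lf lh /GRing.scale /= !mulrDr.
  by rewrite addrACA !mulrA (mulrC a b).
apply: (sub_finite_set (B := [set n | exists w, f (prj n w) != 0] `|`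
                             [set n | exists w, h (prj n w) != 0])).
  move=> n [w]; rewrite !fctE /= => nz.
  have [fz|fz] := eqVneq (f (prj n w)) 0; last by left; exists w.
  by right; exists w; move: nz; rewrite fz scaler0 add0r.
by rewrite finite_setU.
Qed.

(* The restricted dual: the linear functionals that vanish on all but finitely
   many of the summands. *)
Definition gdual_submod := Submod in_gdual0 in_gdualD.
Definition gdual := subspace gdual_submod.

Definition gdual_fun (f : gdual) : W -> C := \val f.
Coercion gdual_fun : gdual >-> Funclass.

(* The pairing with the algebraic completion, whose elements are families
   x : C -> W with x n in the summand of index n. *)
Definition pair_bar (f : gdual) (x : C -> W) : C :=
  \sum_(n \in [set: C]) f (x n).

End GradedDual.

Section Gradings.
Variables (K : pzRingType) (I : choiceType) (W : lmodType K).

Lemma fsum_widen (J : choiceType) (A : set J) (F : J -> W) :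
  finite_set A -> (forall i, ~ A i -> F i = 0) ->
  \sum_(i \in [set: J]) F i = \sum_(i <- fset_set A) F i.
Proof.
move=> fA F0; rewrite -fsbig_finite //; symmetry; apply: fsbig_widen => //.
by move=> i [_ nA]; exact: F0.
Qed.

Lemma linear_seq (W' : lmodType K) (f : W -> W') (J : Type) (s : seq J)
  (F : J -> W) : linear f -> f (\sum_(i <- s) F i) = \sum_(i <- s) f (F i).
Proof.
move=> lf; have f0 : f 0 = 0.
  by have := lf (-1) 0 0; rewrite scaler0 addr0 scaleN1r addNr.
elim: s => [|i s IH]; first by rewrite !big_nil.
by rewrite !big_cons -IH -[F i]scale1r lf !scale1r.
Qed.

Lemma linear_0 (W' : lmodType K) (f : W -> W') : linear f -> f 0 = 0.
Proof.
by move=> lf; have := lf (-1) 0 0; rewrite scaler0 addr0 scaleN1r addNr.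
Qed.

Lemma linear_Z (W' : lmodType K) (f : W -> W') a w :
  linear f -> f (a *: w) = a *: f w.
Proof. by move=> lf; rewrite -[a *: w]addr0 lf (linear_0 lf) addr0. Qed.

Variable prj : I -> W -> W.
Hypothesis prjP : is_grading prj.

Lemma grading_seq w : exists2 s : seq I, uniq s & w = \sum_(i <- s) prj i w.
Proof.
case: prjP => _ _ _ /(_ w) e.
exists (finite_support 0 setT (fun i => prj i w)) => //.
Qed.

Lemma grading_ext (W' : lmodType K) (f h : W -> W') :
  linear f -> linear h -> (forall i w, f (prj i w) = h (prj i w)) -> f =1 h.
Proof.
move=> lf lh e w; have [s _ ->] := grading_seq w.
by rewrite !linear_seq //; apply: eq_bigr.
Qed.

End Gradings.

Definition binC (K : fieldType) (a : K) (i : nat) : K :=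
  (\prod_(j < i) (a - j%:R)) / (i`!)%:R.

(* [vmode u n v] is the coefficient of x^(-n-1) in Y(u, x)v. *)
Record voa (R : realType) := Voa {
  voa_car :> lmodType (Cx R);
  vproj : int -> voa_car -> voa_car;
  vmode : voa_car -> int -> voa_car -> voa_car;
  vac : voa_car;
  conf : voa_car;
  central_charge : Cx R;
  vproj_grading : is_grading vproj;
  vproj_finite : forall n : int, exists (d : nat) (e : 'I_d -> voa_car),
    forall v, exists c : 'I_d -> Cx R, vproj n v = \sum_i c i *: e i;
  vproj_lower : exists N : int, forall n : int, n < N -> forall v, vproj n v = 0;
  vmode_linearl : forall n v, linear (fun u => vmode u n v);
  vmode_linearr : forall u n, linear (vmode u n);
  vmode_truncation : forall u v, exists N : int, forall n : int,
    N <= n -> vmode u n v = 0;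
  vmode_vac : forall n v, vmode vac n v = if n == -1 then v else 0;
  vmode_creation : forall u, vmode u (-1) vac = u /\
    forall n : int, 0 <= n -> vmode u n vac = 0;
  (* the Jacobi identity, in components *)
  vmode_jacobi : forall (u v w : voa_car) (l m n : int),
    \sum_(i \in [set: nat])
      binC (m%:~R : Cx R) i *: vmode (vmode u (l + i%:Z) v) (m + n - i%:Z) w =
    \sum_(i \in [set: nat])
      ((-1) ^+ i * binC (l%:~R : Cx R) i) *:
        (vmode u (m + l - i%:Z) (vmode v (n + i%:Z) w) -
         (-1) ^ l *: vmode v (n + l - i%:Z) (vmode u (m + i%:Z) w));
  virasoro : forall (m n : int) v,
    vmode conf (m + 1) (vmode conf (n + 1) v) -
    vmode conf (n + 1) (vmode conf (m + 1) v) =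
    (m - n)%:~R *: vmode conf (m + n + 1) v +
    (if m + n == 0 then ((m ^+ 3 - m)%:~R / 12%:R * central_charge) *: v else 0);
  vproj_L0 : forall n v, vmode conf 1 (vproj n v) = n%:~R *: vproj n v;
  vmode_derivative : forall u n v,
    vmode (vmode conf 0 u) n v = - (n%:~R *: vmode u (n - 1) v) }.

Section Automorphisms.
Variables (R : realType) (V : voa R).

Definition voa_endo (f : V -> V) : Prop :=
  [/\ linear f, forall u n v, f (vmode u n v) = vmode (f u) n (f v),
      f (vac V) = vac V & f (conf V) = conf V].

Record voa_aut := VoaAut {
  aut_fun :> V -> V;
  aut_inv_fun : V -> V;
  aut_funK : cancel aut_fun aut_inv_fun;
  aut_inv_funK : cancel aut_inv_fun aut_fun;
  aut_endo : voa_endo aut_fun;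
  aut_inv_endo : voa_endo aut_inv_fun }.

Lemma voa_endo_id : voa_endo id.
Proof. by split. Qed.

Lemma voa_endo_comp f h : voa_endo f -> voa_endo h -> voa_endo (f \o h).
Proof.
move=> [lf mf vf cf] [lh mh vh ch]; split => /=.
- by move=> a u v /=; rewrite lh lf.
- by move=> u n v; rewrite mh mf.
- by rewrite vh vf.
- by rewrite ch cf.
Qed.

Definition aut1 : voa_aut :=
  VoaAut (fun=> erefl) (fun=> erefl) voa_endo_id voa_endo_id.

Definition autM (g h : voa_aut) : voa_aut :=
  VoaAut (can_comp (aut_funK g) (aut_funK h))
    (can_comp (aut_inv_funK h) (aut_inv_funK g))
    (voa_endo_comp (aut_endo g) (aut_endo h))
    (voa_endo_comp (aut_inv_endo h) (aut_inv_endo g)).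

Definition autV (g : voa_aut) : voa_aut :=
  VoaAut (aut_inv_funK g) (aut_funK g) (aut_inv_endo g) (aut_endo g).

Record aut_group := AutGroup {
  ag_pred :> voa_aut -> Prop;
  ag1 : ag_pred aut1;
  agM : forall g h, ag_pred g -> ag_pred h -> ag_pred (autM g h);
  agV : forall g, ag_pred g -> ag_pred (autV g) }.

Definition ag_elt (G : aut_group) := {g : voa_aut | G g}.

Definition ag_inv (G : aut_group) (g : ag_elt G) : ag_elt G :=
  exist _ (autV (sval g)) (agV (svalP g)).

End Automorphisms.

Section GradedModules.
Variables (R : realType) (V : voa R).
Local Notation C := (Cx R).

(* [gvop v n k w] is the coefficient of x^(-n-1) (log x)^k in Y_W(v, x)w.
   [gvop_weight] says that this coefficient has weight r - n - 1 + s when v and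
   w have weights r and s; it is what makes the values of Y_W(v, x)w at complex
   numbers elements of the algebraic completion. *)
Record gstr (W : lmodType C) := GStr {
  gproj : C -> W -> W;
  gvop : V -> C -> nat -> W -> W;
  gproj_grading : is_grading gproj;
  gvop_linearl : forall n k w, linear (fun v => gvop v n k w);
  gvop_linearr : forall v n k, linear (gvop v n k);
  gvop_weight : forall (r : int) (n : C) (k : nat) (s : C) v w,
    gproj (r%:~R - n - 1 + s) (gvop (vproj r v) n k (gproj s w)) =
    gvop (vproj r v) n k (gproj s w) }.

Record gmod := GMod {
  gm_car :> lmodType C;
  gm_str :> gstr gm_car }.

End GradedModules.

Section Weights.
Variables (R : realType) (V : voa R).
Local Notation C := (Cx R).

Lemma vproj_L0_comm i (y : V) :
  vproj i (vmode (conf V) 1 y) = i%:~R *: vproj i y.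
Proof.
have [lp0 pp _ _] := vproj_grading V.
apply: (grading_ext (vproj_grading V)
  (f := fun y => vproj i (vmode (conf V) 1 y))
  (h := fun y => i%:~R *: vproj i y)).
- by move=> a u v /=; rewrite (vmode_linearr (conf V) 1 a u v) (lp0 i a).
- by move=> a u v /=; rewrite (lp0 i a) scalerDr !scalerA mulrC.
move=> j w /=; rewrite vproj_L0 (linear_Z _ _ (lp0 i)) pp.
by case: eqP => [->|]//; rewrite !scaler0.
Qed.

Lemma vproj_L1 m (v : V) :
  vproj (m - 1) (vmode (conf V) 2 (vproj m v)) = vmode (conf V) 2 (vproj m v).
Proof.
have [lp0 pp _ vE] := vproj_grading V.
set y := vmode _ 2 _.
have L0y : vmode (conf V) 1 y = (m - 1)%:~R *: y.
  have := @virasoro R V 0 1 (vproj m v).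
  rewrite !add0r (_ : (1 : int) + 1 = 2) //= addr0 => /eqP; rewrite subr_eq => /eqP ->.
  rewrite vproj_L0 (linear_Z _ _ (vmode_linearr (conf V) 2)) -/y -scalerDl.
  by congr (_ *: _); rewrite -intrD addrC.
have z i : i != m - 1 -> vproj i y = 0.
  move=> ne; have := vproj_L0_comm i y; rewrite L0y (linear_Z _ _ (lp0 i)).
  move/eqP; rewrite -subr_eq0 -scalerBl scaler_eq0 -intrB intr_eq0 subr_eq0.
  by rewrite eq_sym (negPf ne) /= => /eqP.
rewrite [RHS](vE y) (fsum_widen (A := [set m - 1])) ?finite_set1 //.
  by rewrite fset_set1 big_seq_fset1.
by move=> i /= /eqP; exact: z.
Qed.

Definition L1pow (j : nat) (v : V) : V := iter j (vmode (conf V) 2) v.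

Lemma L1pow_linear j : linear (L1pow j).
Proof.
elim: j => [|j IH] a u v //=.
by rewrite [L1pow j _]IH (vmode_linearr (conf V) 2 a).
Qed.

Lemma vproj_L1pow j m (v : V) :
  vproj (m - j%:Z) (L1pow j (vproj m v)) = L1pow j (vproj m v).
Proof.
have [lp0 pp _ vE] := vproj_grading V.
elim: j => [|j IH]; first by rewrite subr0 /= pp eqxx.
have -> : forall x : V, L1pow j.+1 x = vmode (conf V) 2 (L1pow j x) by [].
rewrite -IH -[in RHS]vproj_L1.
by congr (vproj _ _); rewrite -addrA -opprD -addn1 PoszD.
Qed.

Definition L1supp (v : V) : set (int * nat) :=
  [set mj | L1pow mj.2 (vproj mj.1 v) != 0].

Lemma L1supp_finite v : finite_set (L1supp v).
Proof.
have [lp0 pp fin _] := vproj_grading V; have [N HN] := vproj_lower V.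
pose S := [set m | vproj m v != 0].
apply: (sub_finite_set
  (B := \bigcup_(m in S) [set (m, j) | j in `I_(`|m - N|%N.+1)])).
  case=> m j /= nz; exists m => /=.
    by apply: contraNN nz => /eqP ->; rewrite (linear_0 (L1pow_linear j)).
  exists j => //; rewrite ltnS leqNgt; apply: contraNN nz => lt.
  rewrite -vproj_L1pow HN //. move: lt => /= lt; rewrite ltrBlDl -ltrBlDr.
  by apply: le_lt_trans (ler_norm _) _; rewrite -abszE ltz_nat.
apply: bigcup_finite; first exact: fin.
by move=> m _; exact/finite_image/finite_II.
Qed.

End Weights.

Section Contragredient.
Variables (R : realType) (V : voa R) (W : gmod V).
Local Notation C := (Cx R).
Local Notation prj := (gproj W).
Local Notation W' := (gdual prj).

(* On V of weight m, (-x^-2)^(L(0)) is (-1)^m x^(-2m), and e^(xL(1)) is the sum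
   of the x^j L(1)^j / j!; moreover log (x^-1) = - log x.  Hence the coefficient
   of x^(-n-1) (log x)^k in
     Y_W (e^(xL(1)) (-x^-2)^(L(0)) v, x^-1) w
   is the sum over m and j of [contra_term v n k w (m, j)]. *)
Definition contra_term (v : V) (n : C) (k : nat) (w : W) (mj : int * nat) : W :=
  ((-1) ^ mj.1 * (-1) ^+ k / (mj.2`!)%:R) *:
    gvop W (L1pow mj.2 (vproj mj.1 v))
      ((mj.1 *+ 2)%:~R - mj.2%:R - n - 2%:R) k w.

Definition contra_op (v : V) (n : C) (k : nat) (w : W) : W :=
  \sum_(mj \in [set: int * nat]) contra_term v n k w mj.

Lemma gvop0 n k (w : W) : gvop W 0 n k w = 0.
Proof. exact: (linear_0 (gvop_linearl W n k w)). Qed.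

Lemma contra_opE (A : set (int * nat)) v n k w :
  finite_set A -> L1supp v `<=` A ->
  contra_op v n k w = \sum_(mj <- fset_set A) contra_term v n k w mj.
Proof.
move=> fA sA; apply: fsum_widen => // mj nA; rewrite /contra_term.
have [->|nz] := eqVneq (L1pow mj.2 (vproj mj.1 v)) 0.
  by rewrite gvop0 scaler0.
by case: nA; apply: sA.
Qed.

Lemma contra_op_linearr v n k : linear (contra_op v n k).
Proof.
move=> a x y; rewrite !(contra_opE _ _ _ (L1supp_finite v) (@subset_refl _ _)).
rewrite scaler_sumr -big_split /=; apply: eq_bigr => mj _.
rewrite /contra_term (gvop_linearr W _ _ _ a) scalerDr !scalerA.
by rewrite (mulrC a).
Qed.

Lemma contra_op_linearl n k w : linear (fun v => contra_op v n k w).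
Proof.
move=> a u v; set A := L1supp u `|` (L1supp v `|` L1supp (a *: u + v)).
have fA : finite_set A by rewrite !finite_setU; split; [|split]; exact: L1supp_finite.
have sA : [/\ L1supp u `<=` A, L1supp v `<=` A & L1supp (a *: u + v) `<=` A].
  by split=> x ?; [left|right; left|right; right].
have [sA1 sA2 sA3] := sA.
rewrite /= (contra_opE _ _ _ fA sA1) (contra_opE _ _ _ fA sA2).
rewrite (contra_opE _ _ _ fA sA3).
rewrite scaler_sumr -big_split /=; apply: eq_bigr => mj _.
have [lp _ _ _] := vproj_grading V.
rewrite /contra_term (lp mj.1 a) (L1pow_linear mj.2 a).
by rewrite (gvop_linearl W _ _ _ a) scalerDr !scalerA (mulrC a).
Qed.

Lemma contra_op_weight (r : int) n k s v (w : W) :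
  prj (s + n + 1 - r%:~R) (contra_op (vproj r v) n k (prj s w)) =
  contra_op (vproj r v) n k (prj s w).
Proof.
have [lp pp _ _] := vproj_grading V; have [lq _ _ _] := gproj_grading W.
rewrite !(contra_opE _ _ _ (L1supp_finite _) (@subset_refl _ _)).
rewrite (linear_seq _ _ (lq _)); apply: eq_bigr => -[m j] _ /=.
rewrite /contra_term /= (linear_Z _ _ (lq _)); congr (_ *: _).
rewrite pp; case: eqP => [->|_]; last first.
  by rewrite (linear_0 (L1pow_linear j)) gvop0 (linear_0 (lq _)).
rewrite -[in RHS]vproj_L1pow -[in RHS]gvop_weight vproj_L1pow; congr (prj _ _).
by rewrite mulr2n !rmorphD /= rmorphN /= -pmulrn; ring.
Qed.

Lemma gdual_linear (phi : W') : scalar (phi : W -> C^o).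
Proof. by have [] := subspaceP phi. Qed.

Lemma gdual0 (phi : W') : phi 0 = 0.
Proof. exact: (linear_0 (gdual_linear phi)). Qed.

Lemma contra_in_gdual v n k (phi : W') :
  in_gdual prj (fun w => phi (contra_op v n k w)).
Proof.
have lphi := gdual_linear phi; have [_ fphi] := subspaceP phi.
have [lq qq _ _] := gproj_grading W.
split.
  by move=> a x y /=; rewrite (contra_op_linearr v n k a) lphi.
have [s _ ->] := grading_seq (vproj_grading V) v.
set S := [set m | _] in fphi.
apply: (sub_finite_set (B := \bigcup_(r in [set` s])
   [set t - n - 1 + r%:~R | t in S])); last first.
  apply: bigcup_finite; first exact: finite_seq.
  by move=> r _; exact: finite_image.
move=> t /= [w].
rewrite (linear_seq s (fun r => vproj r v) (contra_op_linearl n k (prj t w))).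
rewrite (linear_seq s _ lphi) => nz.
have [[r rs nzr]|none] := pselect (exists2 r, r \in s &
     phi (contra_op (vproj r v) n k (prj t w)) != 0); last first.
  move: nz; rewrite big_seq big1 ?eqxx // => r rs; apply/eqP.
  by apply: contrapT => /negP h; apply: none; exists r.
exists r => //; exists (t + n + 1 - r%:~R); last by ring.
exists (contra_op (vproj r v) n k (prj t w)).
by rewrite /= contra_op_weight.
Qed.

Definition contra_vop (v : V) (n : C) (k : nat) (phi : W') : W' :=
  to_subspace (S := gdual_submod prj) (contra_in_gdual v n k phi).

Lemma contra_proj_in_gdual n (phi : W') : in_gdual prj (fun w => phi (prj n w)).
Proof.
have lphi := gdual_linear phi.
have [lq qq _ _] := gproj_grading W; split.
  by move=> a x y /=; rewrite (lq n a) lphi.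
apply: (sub_finite_set (B := [set n])); last exact: finite_set1.
move=> m /= [w]; rewrite qq; case: (n =P m) => [->//|_].
by rewrite gdual0 eqxx.
Qed.

Definition contra_proj (n : C) (phi : W') : W' :=
  to_subspace (S := gdual_submod prj) (contra_proj_in_gdual n phi).

Lemma gdualP (phi psi : W') : phi =1 psi -> phi = psi.
Proof. by move=> e; apply/val_inj/funext. Qed.

Lemma gdual_lin a (phi psi : W') w : gdual_fun (a *: phi + psi) w = a * phi w + psi w.
Proof. by []. Qed.

Lemma gdual_sum (I : Type) (s : seq I) (F : I -> W') w :
  gdual_fun (\sum_(i <- s) F i) w = \sum_(i <- s) F i w.
Proof. by elim/big_rec2: _ => // i x y _ <-. Qed.

Lemma contra_proj_grading : is_grading contra_proj.
Proof.
have [lq qq fw wE] := gproj_grading W; split.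
- move=> n a x y; apply: gdualP => w; rewrite gdual_lin.
  exact: gdual_lin.
- move=> i j phi0; pose phi : W' := phi0; rewrite -/phi; apply: gdualP => w.
  have lphi := gdual_linear phi.
  change (phi (prj j (prj i w)) =
    gdual_fun (if i == j then contra_proj i phi else 0) w).
  rewrite qq eq_sym; case: eqP => [->//|_].
  exact: gdual0.
- move=> phi0; pose phi : W' := phi0; rewrite -/phi; have [_ fphi] := subspaceP phi; apply: sub_finite_set fphi.
  move=> n /= nz; apply: contrapT => h; move/eqP: nz; apply; apply: gdualP => w.
  change (phi (prj n w) = 0).
  by apply: contrapT => hw; apply: h; exists w; apply/eqP.
move=> phi0; pose phi : W' := phi0; rewrite -/phi; apply: gdualP.
have lphi := gdual_linear phi; have [_ fphi] := subspaceP phi.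
set A := [set n | _] in fphi.
have z n w : ~ A n -> phi (prj n w) = 0.
  by move=> nA; apply: contrapT => h; apply: nA; exists w; apply/eqP.
rewrite (fsum_widen (A := A)) // => [w|n nA]; last first.
  by apply: gdualP => w; exact: z.
apply: (grading_ext (gproj_grading W) (f := phi : W -> C^o)
  (h := fun w => gdual_fun (\sum_(i <- fset_set A) contra_proj i phi) w : C^o)) => //.
  exact: gdual_linear.
move=> i x; rewrite gdual_sum.
have E j : contra_proj j phi (prj i x) = if j == i then phi (prj i x) else 0.
  change (phi (prj j (prj i x)) = if j == i then phi (prj i x) else 0).
  by rewrite qq; case: eqP => [->//|_]; exact: gdual0.
rewrite (eq_bigr _ (fun j _ => E j)).
have [Ai|nAi] := pselect (A i).
  rewrite (bigD1_seq i) ?fset_uniq ?in_fset_set ?inE //= eqxx big1 ?addr0 //.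
  by move=> j /negPf ->.
by rewrite big1 ?(z i) // => j _; case: ifP.
Qed.

Lemma contra_linearl n k (phi : W') : linear (fun v => contra_vop v n k phi).
Proof.
move=> a u v; apply: gdualP => w.
change (phi (contra_op (a *: u + v) n k w) =
  a * phi (contra_op u n k w) + phi (contra_op v n k w)).
by rewrite (contra_op_linearl n k w a) (gdual_linear phi).
Qed.

Lemma contra_linearr v n k : linear (contra_vop v n k).
Proof.
by move=> a x y; apply: gdualP => w; rewrite gdual_lin; exact: gdual_lin.
Qed.

Lemma contra_weight (r : int) (n : C) (k : nat) (s : C) v phi :
  contra_proj (r%:~R - n - 1 + s) (contra_vop (vproj r v) n k (contra_proj s phi))
  = contra_vop (vproj r v) n k (contra_proj s phi).
Proof.
have [lq qq _ _] := gproj_grading W; have lphi := gdual_linear phi.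
apply: gdualP => w; set t := _ + s.
pose f x : C^o := phi (prj s (contra_op (vproj r v) n k x)).
have lf : linear f.
  by move=> a x y; rewrite /f (contra_op_linearr _ _ _ a) (lq _ a) lphi.
change (f (prj t w) = f w); apply: (grading_ext (gproj_grading W)
  (f := fun w => f (prj t w)) (h := f)) => //.
  by move=> a x y; rewrite (lq _ a) lf.
move=> i x; rewrite qq; case: eqP => [->//|ne].
rewrite (linear_0 lf) /f -contra_op_weight qq; case: eqP => [e|].
  by case: ne; rewrite /t e; ring.
by rewrite gdual0.
Qed.

Definition contra_str : gstr V W' :=
  GStr contra_proj_grading contra_linearl contra_linearr contra_weight.

Definition contragredient : gmod V := GMod contra_str.

End Contragredient.

Section TwistedModules.
Variables (R : realType) (V : voa R).
Local Notation C := (Cx R).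

(* The p-th branch at z of the sum of the c n k x^(-n-1) (log x)^k, as an
   element of the algebraic completion. *)
Definition eval_bar (W : gmod V) (c : C -> nat -> W) (p : int) (z : C) : C -> W :=
  fun n => \sum_(mk \in [set: C * nat])
    (expC ((- mk.1 - 1) * lp p z) * lp p z ^+ mk.2) *:
      gproj W n (c mk.1 mk.2).

Definition Ybar (W : gmod V) (p : int) (v : V) (z : C) (w : W) : C -> W :=
  eval_bar (fun n k => gvop W v n k w) p z.

Definition YVbar (u : V) (x : C) (v : V) : int -> V :=
  fun n => \sum_(m \in [set: int]) x ^ (- m - 1) *: vproj n (vmode u m v).

Definition twisted_duality (W : gmod V) : Prop :=
  forall (u v : V) (w : W) (w' : contragredient W),
  exists (N : nat) (a : 'I_N.+1 -> 'I_N.+1 -> 'I_N.+1 -> 'I_N.+1 -> C)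
         (r s : 'I_N.+1 -> C) (t : nat), (0 < t)%N /\
  forall (p : int) (z1 z2 : C),
  let f := (\sum_i \sum_j \sum_k \sum_l a i j k l *
              expC (r i * lp p z1) * expC (s j * lp p z2) *
              lp p z1 ^+ k * lp p z2 ^+ l) / (z1 - z2) ^+ t in
  let prod12 := fun n : C =>
    pair_bar w' (Ybar p u z1 (Ybar p v z2 w n)) in
  let prod21 := fun n : C =>
    pair_bar w' (Ybar p v z2 (Ybar p u z1 w n)) in
  let iterate := fun n : int =>
    pair_bar w' (Ybar p (YVbar u (z1 - z2) v n) z2 w) in
  [/\ 0 < cabs z2 < cabs z1 -> abs_sum prod12 f,
      0 < cabs z1 < cabs z2 -> abs_sum prod21 f
    & 0 < cabs (z1 - z2) < cabs z2 ->
        abs_conv iterate /\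
        (`|arg z1 - arg z2| < pi / 2 -> abs_sum iterate f)].

Record generalized_twisted_module (g : voa_aut V) (W : gmod V) : Prop := {
  gtm_log : forall (v : V) (w : W), exists K : nat, forall n k,
    (K < k)%N -> gvop W v n k w = 0;
  gtm_equivariance : forall (p : int) (z : C) (v : V) (w : W), z != 0 ->
    Ybar (p + 1) (g v) z w = Ybar p v z w;
  gtm_vacuum : forall n k (w : W),
    gvop W (vac V) n k w = if (n == -1) && (k == 0%N) then w else 0;
  gtm_duality : twisted_duality W;
  gtm_L0 : forall (n : C) (w : W), gproj W n w = w -> exists K : nat,
    (0 < K)%N /\
    iter K (fun x => gvop W (conf V) 1 0%N x - n *: x) w = 0;
  gtm_derivative : forall (v : V) n k (w : W),
    gvop W (vmode (conf V) 0 v) n k w =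
    - n *: gvop W v (n - 1) k w + k.+1%:R *: gvop W v (n - 1) k.+1 w }.

Definition lower_bounded (W : gmod V) : Prop :=
  forall n : C, exists b : R, forall l : R, l < b ->
    forall w : W, gproj W (n + ofR l) w = 0.

Definition twisted_module (g : voa_aut V) (W : gmod V) : Prop :=
  generalized_twisted_module g W /\ lower_bounded W.

Definition module_map (W1 W2 : gmod V) (f : W1 -> W2) : Prop :=
  linear f /\ forall v n k w, f (gvop W1 v n k w) = gvop W2 v n k (f w).

Definition equivalent (W1 W2 : gmod V) : Prop :=
  exists2 f : W1 -> W2, module_map f & bijective f.

(* [Y w1 n k w2] is the coefficient of x^(-n-1) (log x)^k in Y(w1, x)w2. *)

Definition intertwining_duality (W1 W2 W3 : gmod V)
    (Y : W1 -> C -> nat -> W2 -> W3) : Prop :=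
  forall (u : V) (w1 : W1) (w2 : W2) (w3' : contragredient W3),
  exists2 fe : 'rV[C]_2 -> C,
    branch_of_multivalued (@Mconf R 2) (@cut2 R) (@Mconf R 2) fe &
  forall z1 z2 : C,
  let Yv := fun x1 x2 => eval_bar (fun n k => Y x1 n k x2) 0 z2 in
  let prod12 := fun n : C => pair_bar w3' (Ybar 0 u z1 (Yv w1 w2 n)) in
  let prod21 := fun n : C => pair_bar w3' (Yv w1 (Ybar 0 u z1 w2 n)) in
  let iterate := fun n : C => pair_bar w3' (Yv (Ybar 0 u (z1 - z2) w1 n) w2) in
  [/\ 0 < cabs z2 < cabs z1 ->
        abs_conv prod12 /\
        (`|arg (z1 - z2) - arg z1| < pi / 2 -> abs_sum prod12 (fe (pt2 z1 z2))),
      0 < cabs z1 < cabs z2 ->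
        abs_conv prod21 /\
        (- (3 * pi / 2) < arg (z1 - z2) - arg z2 < - (pi / 2) ->
         abs_sum prod21 (fe (pt2 z1 z2)))
    & 0 < cabs (z1 - z2) < cabs z2 ->
        abs_conv iterate /\
        (`|arg z1 - arg z2| < pi / 2 -> abs_sum iterate (fe (pt2 z1 z2)))].

Definition add_last (m : nat) (z : 'rV[C]_m) (zk : C) : 'rV[C]_m.+1 :=
  \row_i oapp (fun j => z 0 j) zk (unlift ord_max i).

(* The condition on products of k - 1 = m twisted vertex operators and one
   intertwining operator.  The component-isolated singularities are those on
   any open set Omega, containing the points (z_1, ..., z_m) with
   (z_1, ..., z_m, z_k) in M^k, on which the function continues: the factor
   prod (z_i - z_j)^M_ij may extend it across the diagonals z_i = z_j. *)
Definition intertwining_convergence (W1 W2 W3 : gmod V)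
    (Y : W1 -> C -> nat -> W2 -> W3) : Prop :=
  forall (m : nat) (u : 'I_m -> V) (w1 : W1) (w2 : W2)
    (w3' : contragredient W3), (2 <= m)%N ->
  let D : set 'rV[C]_m.+1 := [set z | (forall i, z 0 i != 0) /\
    (forall i j : 'I_m.+1, (i < j)%N -> cabs (z 0 j) < cabs (z 0 i))] in
  let coord := fun (i : 'I_m.+1) (z : 'rV[C]_m.+1) => z 0 i in
  let M := @Mconf R m.+1 in
  let product := fun (z : 'rV[C]_m.+1) (n : {ffun 'I_m -> C}) => pair_bar w3'
    (foldr (fun i x => Ybar 0 (u i) (z 0 (lift ord_max i)) (x (n i)))
       (eval_bar (fun n k => Y w1 n k w2) 0 (z 0 ord_max)) (enum 'I_m)) in
  exists f : 'rV[C]_m.+1 -> C,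
  [/\ forall z, D z -> abs_sum (product z) (f z),
      branch_of_multivalued M coord D f
    & forall (zk : C) (e : 'I_m -> 'I_m -> nat), zk != 0 ->
      (forall i j : 'I_m, (i < j)%N -> (0 < e i j)%N /\
         forall n : int, (e i j)%:Z <= n -> vmode (u i) n (u j) = 0) ->
      forall a phi (b : 'rV[C]_m) psi (Omega : set 'rV[C]_m) beta delta,
      let F := fun z : 'rV[C]_m =>
        (\prod_(i < m) \prod_(j < m | (i < j)%N) (z 0 i - z 0 j) ^+ e i j) *
        psi (add_last z zk) in
      D a -> upper_agree coord D f phi a ->
      continues_to M a phi (add_last b zk) psi ->
      open Omega -> (forall z, M (add_last z zk) -> Omega z) ->
      continuable Omega b F ->
      component_isolated Omega beta delta ->
      regular_singularity Omega b F beta delta].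

Record intertwining_operator (W1 W2 W3 : gmod V)
    (Y : W1 -> C -> nat -> W2 -> W3) : Prop := {
  io_linearl : forall n k w2, linear (fun w1 => Y w1 n k w2);
  io_linearr : forall w1 n k, linear (Y w1 n k);
  io_log : forall w1 w2, exists K : nat, forall n k,
    (K < k)%N -> Y w1 n k w2 = 0;
  (* see [gvop_weight] *)
  io_weight : forall (r n : C) k (s : C) w1 w2,
    gproj W3 (r - n - 1 + s) (Y (gproj W1 r w1) n k (gproj W2 s w2)) =
    Y (gproj W1 r w1) n k (gproj W2 s w2);
  io_truncation : forall w1 w2 n k, exists N : nat, forall l : nat,
    (N <= l)%N -> Y w1 (n + l%:R) k w2 = 0;
  io_duality : intertwining_duality Y;
  io_convergence : intertwining_convergence Y;
  io_derivative : forall w1 n k w2,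
    Y (gvop W1 (conf V) 0 0%N w1) n k w2 =
    - n *: Y w1 (n - 1) k w2 + k.+1%:R *: Y w1 (n - 1) k.+1 w2 }.

(* A linear map from the tensor product of W1 and W2 to the completion of W3 is
   given by its weight components on the pure tensors. *)
Definition Pz_intertwining_map (z : C) (W1 W2 W3 : gmod V)
    (I : W1 -> W2 -> C -> W3) : Prop :=
  exists2 Y : W1 -> C -> nat -> W2 -> W3, intertwining_operator Y &
    forall w1 w2, I w1 w2 = eval_bar (fun n k => Y w1 n k w2) 0 z.

End TwistedModules.

Section Category.
Variables (R : realType) (V : voa R) (G : aut_group V).
Local Notation C := (Cx R).

Definition is_Gmodule (W : lmodType C) (rho : ag_elt G -> W -> W) : Prop :=
  [/\ forall h, linear (rho h),
      forall h w, sval h = aut1 V -> rho h w = w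
    & forall h1 h2 h w, sval h = autM (sval h1) (sval h2) ->
        rho h w = rho h1 (rho h2 w)].

(* The summands W^[alpha] are indexed by the representatives alpha of C / Z
   with 0 <= Re alpha < 1. *)
Definition generalized_eigenspaces (W : gmod V) (T : W -> W) : Prop :=
  exists q : C -> W -> W,
    [/\ is_grading q,
        forall alpha w, ~~ (0 <= cRe alpha < 1) -> q alpha w = 0,
        forall n alpha w, gproj W n (q alpha w) = q alpha (gproj W n w)
      & exists Lambda : nat, (0 < Lambda)%N /\ forall alpha w,
          iter Lambda (fun x => T x - expC (Complex 0 (2 * pi) * alpha) *: x)
            (q alpha w) = 0].

Definition has_G_action (g : voa_aut V) (W : gmod V)
    (rho : ag_elt G -> W -> W) : Prop :=
  is_Gmodule rho /\
  exists Gg : G g, let T := rho (exist _ g Gg) in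
    (forall u n k w, T (gvop W u n k w) = gvop W (g u) n k (T w)) /\
    generalized_eigenspaces T.

Record tw_obj := TwObj {
  tw_aut : voa_aut V;
  tw_mod :> gmod V;
  tw_act : option (ag_elt G -> tw_mod -> tw_mod) }.

(* The transpose of [rho h^-1]; 0 when that transpose does not preserve the
   restricted dual, so that no G-module structure arises in that case. *)
Definition contra_act (W : gmod V) (rho : ag_elt G -> W -> W) (h : ag_elt G)
    (f : contragredient W) : contragredient W :=
  match pselect (in_gdual (gproj W)
           (fun w => gdual_fun f (rho (ag_inv h) w))) with
  | left Hf => to_subspace (S := gdual_submod (gproj W)) Hf
  | right _ => 0
  end.

Definition contra_obj (W : tw_obj) : tw_obj :=
  @TwObj (autV (tw_aut W)) (contragredient W)
    (if tw_act W is Some rho then Some (contra_act rho) else None).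

(* Full subcategories: all module maps are morphisms. *)
Definition twisted_category (Cat : tw_obj -> Prop) : Prop :=
  (forall W, Cat W ->
     [/\ G (tw_aut W), twisted_module (tw_aut W) W & tw_act W = None]) \/
  (forall W, Cat W ->
     [/\ G (tw_aut W), twisted_module (tw_aut W) W
       & exists2 rho, tw_act W = Some rho & has_G_action (tw_aut W) rho]).

Section TensorProduct.
Variables (Cat : tw_obj -> Prop) (z : C) (W1 W2 : tw_obj).

Definition Pz_product (W3 : tw_obj) (I : W1 -> W2 -> C -> W3) : Prop :=
  [/\ Cat W3, tw_aut W3 = autM (tw_aut W1) (tw_aut W2)
    & Pz_intertwining_map z I].

Definition lambda (W3 : gmod V) (I : W1 -> W2 -> C -> W3)
    (w3' : contragredient W3) : W1 -> W2 -> C^o :=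
  fun w1 w2 => pair_bar w3' (I w1 w2).

Definition box_gen (l : W1 -> W2 -> C^o) : Prop :=
  exists (W3 : tw_obj) (I : W1 -> W2 -> C -> W3) (w3' : contragredient W3),
    Pz_product I /\ l = lambda I w3'.

(* Elements of the dual of the tensor product are bilinear forms. *)
Definition box : lmodType C := subspace (span box_gen).

(* [S] is the grading and the vertex operator map of the box space; [act] is
   None, or a G-action with a decomposition of the box space into generalized
   eigenspaces of g1 g2. *)
Definition box_structure (S : gstr V box)
    (act : option (ag_elt G -> box -> box)) : Prop :=
  (forall (W3 : tw_obj) (I : W1 -> W2 -> C -> W3) (w3' : contragredient W3)
      (l : box), Pz_product I -> \val l = lambda I w3' ->
    (forall v n k,
       \val (gvop S v n k l) = lambda I (gvop (contragredient W3) v n k w3')) /\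
    (forall n, \val (gproj S n l) = lambda I (gproj (contragredient W3) n w3'))) /\
  (if act is Some rho then
     is_Gmodule rho /\
     exists Gg : G (autM (tw_aut W1) (tw_aut W2)),
       @generalized_eigenspaces (GMod S) (rho (exist _ _ Gg))
   else True).

Definition box_obj (S : gstr V box) (act : option (ag_elt G -> box -> box)) :
    tw_obj :=
  @TwObj (autV (autM (tw_aut W1) (tw_aut W2))) (GMod S) act.

Definition tensor_obj (S : gstr V box) (act : option (ag_elt G -> box -> box)) :
    tw_obj :=
  contra_obj (box_obj S act).

Lemma box_linE (a : C) (x y : box) (w1 : W1) (w2 : W2) :
  \val (a *: x + y) w1 w2 = a * \val x w1 w2 + \val y w1 w2.
Proof. by have -> := subspace_linE a x y. Qed.

Lemma box_component_in_gdual (S : gstr V box) (w1 : W1) (w2 : W2) (n : C) :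
  in_gdual (gproj S) (fun l => \val (gproj S n l) w1 w2).
Proof.
have [lp pp _ _] := gproj_grading S; split.
  move=> a x y; have -> := lp n a x y.
  exact: box_linE.
apply: (sub_finite_set (B := [set n])); last exact: finite_set1.
move=> m [l]; rewrite pp; case: (n =P m) => [->//|_ /eqP h].
by case: h.
Qed.

(* The completion of the contragredient of the box space is the full dual of
   the box space; the component of weight n of a functional is its composition
   with the projection onto the summand of weight n. *)
Definition box_map (S : gstr V box) (act : option (ag_elt G -> box -> box))
    (w1 : W1) (w2 : W2) : C -> tensor_obj S act :=
  fun n => to_subspace (S := gdual_submod (gproj S))
             (box_component_in_gdual S w1 w2 n).

Lemma box_sumE (I : Type) (s : seq I) (F : I -> box) (w1 : W1) (w2 : W2) :
  \val (\sum_(i <- s) F i) w1 w2 = \sum_(i <- s) (\val (F i) w1 w2 : C^o).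
Proof.
elim: s => [|i s IH].
  by rewrite !big_nil; have -> := subspace_0E (span box_gen).
by rewrite !big_cons -IH -[X in X + _]scale1r box_linE mul1r.
Qed.

Lemma box_map_pairing (S : gstr V box) act (w1 : W1) (w2 : W2) (l : box) :
  \sum_(n \in [set: C])
    (gdual_fun (box_map S act w1 w2 n : gdual (gproj S)) l : C^o) =
  \val l w1 w2.
Proof.
have [_ _ fl lE] := gproj_grading S; set A := [set n | gproj S n l != 0].
have z0 n : ~ A n -> gproj S n l = 0.
  by move=> nA; apply: contrapT => h; apply: nA; apply/eqP.
have lA : l = \sum_(n <- fset_set A) gproj S n l.
  by rewrite {1}(lE l); exact: (fsum_widen (fl l) z0).
transitivity (\sum_(n <- fset_set A) (\val (gproj S n l) w1 w2 : C^o)).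
  apply: (fsum_widen (F := fun n => \val (gproj S n l) w1 w2 : C^o) (fl l)).
  by move=> n /z0 ->.
by rewrite -box_sumE -lA.
Qed.

(* A module map f commutes with L(0), hence preserves the weights, and its
   extension to the completions acts on the components. *)
Definition Pz_tensor_product (T : tw_obj) (bx : W1 -> W2 -> C -> T) : Prop :=
  Pz_product bx /\
  forall (W3 : tw_obj) (I : W1 -> W2 -> C -> W3), Pz_product I ->
    exists! f : T -> W3,
      module_map f /\ forall w1 w2, I w1 w2 = f \o bx w1 w2.

End TensorProduct.

Definition tensor_assumption (Cat : tw_obj -> Prop) (z : C) : Prop :=
  (forall W1 W2, Cat W1 -> Cat W2 ->
     exists (S : gstr V (box Cat z W1 W2)) act,
       box_structure S act /\ Cat (tensor_obj S act)) /\
  (forall W, Cat W -> equivalent (contra_obj (contra_obj W)) W).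

End Category.

(* Main.v *)
Require Import Defs.
From mathcomp Require Import all_boot all_order all_algebra.
From mathcomp Require Import finmap.
From mathcomp Require Import all_classical all_reals all_analysis.
From mathcomp Require Import ring.

(**
The universal property is obtained by transposing.  A P(z)-product (W3, I)
gives a map [lambda_box] from W3' to the box space B, sending w3' to
lambda_{I,w3'}; it commutes with the vertex operators and with the projections
onto the weight spaces because this is how the structure of B is defined.  Its
transpose goes from T = B' to W3'', and it sends the weight n component of the
functional l |-> l(w1 (x) w2) to the evaluation of functionals at the weight n
component of I(w1 (x) w2).  That evaluation is in the canonical image of W3 in
W3'', on which the vertex operators of W3'' and W3 agree
([double_contra_op]).  So everything follows once T is known to be spanned by
the components of the elements w1 [x] w2: the module map is unique because it
is prescribed on these components, and it exists because the transpose sends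
them, hence all of T, into W3 ([transpose_exists], [transpose_module_map]).

The spanning ([box_components_span]) is where the double contragredient enters.
The components of weight n are functionals on the weight space B_n that have no
common zero, since an element of B is a bilinear form on W1 x W2.  Such
functionals span the dual of B_n when B_n has finite dimension, but not in
general.  Now T is an object of the category, so T'' is isomorphic to T.  The
isomorphism preserves weights ([double_contra_iso_weight]), although L(0) - n
need not be locally nilpotent on the weight space of T'' a priori: for m
different from n, the injectivity of L(0) - m on a weight space of weight n
passes to the second dual.  Hence B_n*** is isomorphic to B_n*, and this forces
B_n to have finite dimension ([finite_weight_space]).

The last implication needs only that B_n* cannot be mapped onto B_n***, even by
a map that is not linear.  Take an infinite basis E of B_n.  An element of B_n*
is a function c : E -> C; it extends to a multiplicative function on words in
the letters E, and distinct multiplicative functions are linearly independent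
([characters_independent]).  There are as many words as letters
([words_injection]), so B_n**, which contains functionals with arbitrary values
on the dual family of E, contains a linearly independent family indexed by
B_n* itself ([many_functionals]).  A functional on B_n** can be prescribed on
this family, and the diagonal choice gives one that is missed by any given map
from B_n*.
*)

Set Implicit Arguments.
Unset Strict Implicit.
Unset Printing Implicit Defensive.
Import Order.TTheory GRing.Theory Num.Theory.

Local Open Scope classical_set_scope.
Local Open Scope ring_scope.

(** * Words over an infinite alphabet *)

Section Words.
Variable I : choiceType.
Implicit Types (A B : set I) (c : seq I -> I) (s t : seq I).

Definition entries_in A s := forall x, x \in s -> A x.

Definition inj_into A B (h : I -> I) :=
  (forall x, A x -> B (h x)) /\ (forall x y, A x -> A y -> h x = h y -> x = y).

(** Zorn's lemma for partial matchings between A and B: a maximal matching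
    exhausts one of the two sets. *)
Lemma comparable_sets A B :
  (exists h, inj_into A B h) \/ (exists h, inj_into B A h).
Proof.
pose P (G : set (I * I)) := [/\ forall x y, G (x, y) -> A x /\ B y,
  forall x y z, G (x, y) -> G (x, z) -> y = z
  & forall x y z, G (x, z) -> G (y, z) -> x = y].
have [|G [[G1 G2 G3] Gmax]] := @Zorn_bigcup _ P.
  move=> F FP Ftot; split.
  - by move=> x y [X FX Xxy]; have [+ _ _] := FP X FX; exact.
  - move=> x y z [X FX Xx] [Y FY Yx]; have [XY|YX] := Ftot X Y FX FY.
      by have [_ h _] := FP Y FY; apply: h Yx; exact: XY.
    by have [_ h _] := FP X FX; apply: (h x) => //; exact: YX.
  - move=> x y z [X FX Xx] [Y FY Yx]; have [XY|YX] := Ftot X Y FX FY.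
      by have [_ _ h] := FP Y FY; apply: h Yx; exact: XY.
    by have [_ _ h] := FP X FX; apply: (h _ _ z) => //; exact: YX.
have [dom|/existsNP[a /not_implyP[Aa na]]] :=
    pselect (forall x, A x -> exists y, G (x, y)).
  left; have /choice[h hP] : forall x, exists y, A x -> G (x, y).
    move=> x; have [/dom[y Gy]|nA] := pselect (A x); first by exists y.
    by exists x.
  exists h; split=> [x /hP /G1[]//|x y /hP Gx /hP Gy e].
  by apply: G3 Gx _; rewrite e.
have [rng|/existsNP[b /not_implyP[Bb nb]]] :=
    pselect (forall y, B y -> exists x, G (x, y)).
  right; have /choice[h hP] : forall y, exists x, B y -> G (x, y).
    move=> x; have [/rng[y Gy]|nA] := pselect (B x); first by exists y.
    by exists x.
  exists h; split=> [x /hP /G1[]//|x y /hP Gx /hP Gy e].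
  by apply: G2 Gx _; rewrite e.
exfalso; apply: (Gmax (G `|` [set (a, b)])).
  split; first exact: subsetUl.
  by move=> /(_ (a, b) (or_intror erefl)) Gab; apply: na; exists b.
split.
- by move=> x y [/G1//|[-> ->]].
- move=> x y z [Gx|[ex ey]] [Gx'|[ex' ez]]; subst => //.
  + exact: G2 Gx Gx'.
  + by case: na; exists y.
  + by case: na; exists z.
- move=> x y z [Gx|[ex ey]] [Gx'|[ex' ez]]; subst => //.
  + exact: G3 Gx Gx'.
  + by case: nb; exists x.
  + by case: nb; exists y.
Qed.

(** A is closed under [c], and [c] is injective on the words in A.  The letters
    are restricted to A, rather than [c] being defined on a smaller type, so that
    codings of growing sets can be compared. *)
Definition coding A c :=
  (forall s, entries_in A s -> A (c s)) /\
  (forall s t, entries_in A s -> entries_in A t -> c s = c t -> s = t).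

Lemma entries_in_map A B (h : I -> I) s :
  (forall x, A x -> B (h x)) -> entries_in A s -> entries_in B (map h s).
Proof. by move=> hAB As _ /mapP[x xs ->]; apply/hAB/As. Qed.

Lemma entries_in_pair A x y : A x -> A y -> entries_in A [:: x; y].
Proof. by move=> Ax Ay z; rewrite !inE => /orP[] /eqP->. Qed.

Lemma map_inj_entries A s t (T : eqType) (h : I -> T) :
  (forall x y, A x -> A y -> h x = h y -> x = y) ->
  entries_in A s -> entries_in A t -> map h s = map h t -> s = t.
Proof.
move=> hI; elim: s t => [|x s IH] [|y t] //= As At [e es].
have := hI _ _ (As x (mem_head _ _)) (At y (mem_head _ _)) e => ->.
congr (_ :: _); apply: IH es => z zs.
  by apply: As; rewrite inE zs orbT.
by apply: At; rewrite inE zs orbT.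
Qed.

(** A word over D is encoded by two words over A: the images of its letters
    under [tau], and the marks [b] of its letters, written with two elements of A
    that stand for true and false.  The code of the pair is again a word of
    length two. *)
Lemma coding_double A c D (tau : I -> I) (b : I -> bool) :
  coding A c -> (forall x, D x -> A (tau x)) ->
  (forall x y, D x -> D y -> tau x = tau y -> b x = b y -> x = y) ->
  exists c2, (forall s, entries_in D s -> A (c2 s)) /\
    (forall s t, entries_in D s -> entries_in D t -> c2 s = c2 t -> s = t).
Proof.
move=> [cA cI] tA tI.
have An : entries_in A [::] by [].
pose a0 := c [::]; have Aa0 : A a0 by exact: cA.
have An1 : entries_in A [:: a0] by move=> x; rewrite inE => /eqP->.
pose a1 := c [:: a0]; have Aa1 : A a1 by exact: cA.
(* The codes of the words [::] and [:: a0] are two different elements of A. *)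
have ne : a1 <> a0 by move/(cI _ _ An1 An).
pose be x := if b x then a1 else a0.
have bA x : D x -> A (be x) by rewrite /be; case: ifP.
pose c2 s := c [:: c (map tau s); c (map be s)].
have pairA s : entries_in D s -> entries_in A [:: c (map tau s); c (map be s)].
  by move=> Ds; apply: entries_in_pair; apply: (cA _); exact: entries_in_map Ds.
have c2A s : entries_in D s -> A (c2 s) by move=> /pairA; exact: cA.
exists c2; split=> // s t Ds Dt e.
have [e1 e2] := cI _ _ (pairA s Ds) (pairA t Dt) e.
have {}e1 := cI _ _ (entries_in_map tA Ds) (entries_in_map tA Dt) e1.
have {}e2 := cI _ _ (entries_in_map bA Ds) (entries_in_map bA Dt) e2.
apply: (@map_inj_entries D s t _ (fun x => (tau x, be x))) => //.
  move=> x y Dx Dy [et]; rewrite /be => eb; apply: tI => //.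
  by move: eb; case: (b x); case: (b y) => // /esym.
move: e1 e2; clear Ds Dt e; elim: s t => [|x s IH] [|y t] //= [-> es] [-> et].
by congr (_ :: _); exact: IH.
Qed.

(** An infinite set contains a copy of the natural numbers, and the words over
    a countable set are countable. *)
Lemma coding_nat : infinite_set [set: I] -> exists A c, coding A c.
Proof.
move=> /infiniteP /card_leP [h0].
pose h n : I := \val (h0 (exist _ n (mem_setT n))).
pose A := range h.
have hI x y : h x = h y -> x = y.
  by move=> /val_inj /(inj (f := h0) (mem_setT _) (mem_setT _)) [].
have /choice[g gK] : forall x, exists m, A x -> h m = x.
  move=> x; have [[m _ <-]|nA] := pselect (A x); first by exists m.
  by exists 0%N.
exists A, (fun s => h (choice.pickle (map g s))); split.
  by move=> s _; exists (choice.pickle (map g s)).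
move=> s t As At /hI /(pcan_inj choice.pickleK).
apply: map_inj_entries As At => x y Ax Ay e.
by rewrite -(gK x Ax) e gK.
Qed.

(** If a copy h(A) of A lies outside A, the coding of A extends to the union:
    words over the union that leave A are encoded in A by [coding_double], the
    mark of a letter telling which copy it comes from, and the code is then moved
    to h(A), where it cannot clash with the old codes. *)
Lemma coding_extend A c (h : I -> I) :
  coding A c -> inj_into A (~` A) h ->
  exists A' c', [/\ coding A' c', A `<=` A', (forall s, entries_in A s -> c' s = c s)
    & exists2 x, A' x & ~ A x].
Proof.
move=> cod [hA hI]; have [cA cI] := cod.
pose A' := A `|` h @` A.
have /choice[tau tauP] : forall x, exists y,
    (A x -> y = x) /\ (~ A x -> (h @` A) x -> A y /\ h y = x).
  move=> x; have [Ax|nA] := pselect (A x); first by exists x; split.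
  have [[y Ay hy]|nhA] := pselect ((h @` A) x); first by exists y; split=> // _ _; split.
  by exists x; split.
have tA x : A' x -> A (tau x).
  have [Ax _|nA] := pselect (A x); first by rewrite (tauP x).1.
  by case=> // hx; case: ((tauP x).2 nA hx).
have [|c2 [c2A c2I]] := @coding_double A c A' tau (fun x => `[< A x >]) cod tA.
  move=> x y A'x A'y e exy.
  have [Ax|nAx] := pselect (A x).
    have Ay : A y by apply/asboolP; rewrite -exy; exact/asboolP.
    by rewrite -((tauP x).1 Ax) e ((tauP y).1 Ay).
  have nAy : ~ A y by move=> /asboolP; rewrite -exy => /asboolP.
  have [//|hx] := A'x; have [//|hy] := A'y.
  by rewrite -((tauP x).2 nAx hx).2 e ((tauP y).2 nAy hy).2.
pose c' s := if `[< entries_in A s >] then c s else h (c2 s).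
exists A', c'; split.
- split=> [s A's|s t A's A't]; rewrite /c'.
    case: asboolP => [As|_]; first by left; exact: cA.
    by right; exists (c2 s) => //; exact: c2A.
  case: asboolP => [As|_]; case: asboolP => [At|_].
  + exact: cI.
  + by move=> e; case: (hA _ (c2A t A't)); rewrite -e; exact: cA.
  + by move=> e; case: (hA _ (c2A s A's)); rewrite e; exact: cA.
  + by move=> /(hI _ _ (c2A s A's) (c2A t A't)); exact: c2I.
- by move=> x; left.
- by move=> s As; rewrite /c'; case: asboolP.
- have Ac : A (c [::]) by exact: cA.
  by exists (h (c [::])); [right; exists (c [::])|exact: hA].
Qed.

Lemma entries_in_chain (F : set (set I)) s X0 : F X0 -> total_on F subset ->
  entries_in (\bigcup_(X in F) X) s -> exists2 X, F X & entries_in X s.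
Proof.
move=> FX0 Ftot; elim: s => [_|x s IH ov]; first by exists X0.
have [X FX Xs] : exists2 X, F X & entries_in X s.
  by apply: IH => y ys; apply: ov; rewrite inE ys orbT.
have [Y FY Yx] := ov x (mem_head _ _).
have [XY|YX] := Ftot X Y FX FY.
  by exists Y => // y; rewrite inE => /predU1P[->//|/Xs/XY].
by exists X => // y; rewrite inE => /predU1P[->//|/Xs//]; exact: YX.
Qed.

(** Zorn's lemma for pairs of a subset and a coding of it.  If (A, c) is
    maximal, the complement of A contains no copy of A, by [coding_extend]; so it
    embeds into A, hence the whole alphabet embeds into two copies of A, and
    [coding_double] encodes its words. *)
Theorem words_injection : infinite_set [set: I] ->
  exists c : seq I -> I, injective c.
Proof.
move=> /coding_nat[A0 [c0 cod0]].
pose T := {Ac : set I * (seq I -> I) | coding Ac.1 Ac.2}.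
pose t0 : T := exist _ (A0, c0) cod0.
pose R (x y : T) := `[< (sval x).1 `<=` (sval y).1 /\
  forall s, entries_in (sval x).1 s -> (sval y).2 s = (sval x).2 s >].
have Rrefl x : R x x by apply/asboolP; split.
have Rtrans x y w : R x y -> R y w -> R x w.
  move=> /asboolP[xy1 xy2] /asboolP[yw1 yw2]; apply/asboolP; split.
    by move=> i /xy1 /yw1.
  by move=> s xs; rewrite yw2 ?xy2 // => i /xs /xy1.
have [Fx Ftot|[[A c] /= cod] premax] := @ZL_preorder T t0 R Rrefl Rtrans.
  have [[x0 Fx0]|F0] := pselect (exists x, Fx x); last first.
    by exists t0 => y Fy; case: F0; exists y.
  pose FA := [set (sval x).1 | x in Fx]; pose A := \bigcup_(X in FA) X.
  have FAtot : total_on FA subset.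
    move=> _ _ [x Fxx <-] [y Fy <-].
    by have [/asboolP[]|/asboolP[]] := Ftot x y Fxx Fy; [left|right].
  have FAx0 : FA (sval x0).1 by exists x0.
  have /choice[c cP] : forall s, exists r, forall x, Fx x -> entries_in (sval x).1 s ->
      r = (sval x).2 s.
    move=> s.
    have [[x Fxx xs]|no] := pselect (exists2 x, Fx x & entries_in (sval x).1 s).
      exists ((sval x).2 s) => y Fy ys.
      by have [/asboolP[_ ->]|/asboolP[_ ->]] := Ftot x y Fxx Fy.
    by exists ((sval x0).2 s) => x Fxx xs; case: no; exists x.
  have cod : coding A c.
    split=> [s As|s t As At e].
      have [_ [x Fxx <-] xs] := entries_in_chain FAx0 FAtot As.
      exists (sval x).1; first by exists x.
      by rewrite (cP s x) //; case: (svalP x) => + _; exact.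
    have Ast : entries_in A (s ++ t).
      by move=> x; rewrite mem_cat => /orP[/As|/At].
    have [_ [x Fxx <-] xst] := entries_in_chain FAx0 FAtot Ast.
    have xs : entries_in (sval x).1 s by move=> y ys; apply: xst; rewrite mem_cat ys.
    have xt : entries_in (sval x).1 t by move=> y ys; apply: xst; rewrite mem_cat ys orbT.
    by case: (svalP x) => _; apply=> //; rewrite -!cP.
  exists (exist _ (A, c) cod) => x Fxx; apply/asboolP; split=> /= [y xy|s xs].
    by exists (sval x).1 => //; exists x.
  exact: cP.
have [[h hP]|[h [hA hI]]] := comparable_sets A (~` A).
  have [A' [c' [cod' AA' cc' [x A'x nAx]]]] := coding_extend cod hP.
  have /asboolP[/= A'A _] : R (exist _ (A', c') cod') (exist _ (A, c) cod).
    by apply: premax; apply/asboolP.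
  by case: nAx; exact: A'A.
pose tau x := if `[< A x >] then x else h x.
have tA x : [set: I] x -> A (tau x).
  by move=> _; rewrite /tau; case: asboolP => // /hA.
have [|c2 [_ c2I]] := @coding_double A c setT tau (fun x => `[< A x >]) cod tA.
  move=> x y _ _; rewrite /tau.
  by case: asboolP => Ax; case: asboolP => Ay // e _; exact: hI e.
by exists c2 => s t; exact: c2I.
Qed.

End Words.

(** * Spans, bases and extension of functionals *)

Section Span.
Variables (K : pzRingType) (W : lmodType K).

Lemma in_span_gen (gen : W -> Prop) x : gen x -> in_span gen x.
Proof.
move=> gx; rewrite -[x]addr0 -[x in x + _]scale1r.
by apply: in_spanD => //; exact: in_span0.
Qed.

Lemma in_span_sum (gen : W -> Prop) (I : eqType) (s : seq I) (a : I -> K)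
    (F : I -> W) :
  (forall i, i \in s -> in_span gen (F i)) ->
  in_span gen (\sum_(i <- s) a i *: F i).
Proof.
elim: s => [|i s IH] h; first by rewrite big_nil; exact: in_span0.
rewrite big_cons; apply: in_span_linear; first by apply: h; exact: mem_head.
by apply: IH => j js; apply: h; rewrite inE js orbT.
Qed.

End Span.

Section LinearAlgebra.
Variables (K : fieldType) (W : lmodType K).

(** A functional on a subspace is a linear relation G between W and K; Zorn's
    lemma for the relations that are single-valued extends it to all of W.
    Arguing with relations avoids choosing bases and subspace types: a functional
    is specified by listing the values that it should take. *)
Lemma functional_extension (G : submod (W * K^o)%type) :
  (forall k, G (0, k) -> k = 0) ->
  exists phi : W -> K^o, linear phi /\ forall w k, G (w, k) -> phi w = k.
Proof.
move=> G0.
pose lin (X : set (W * K^o)) := [/\ G `<=` X,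
  forall a x y, X x -> X y -> X (a *: x + y) & forall k, X (0, k) -> k = 0].
(* The empty set is admitted because it is the union of the empty chain. *)
pose P X := X = set0 \/ lin X.
have linG : lin G by split=> // a x y; exact: submod_predD.
have [|X [PX Xmax]] := @Zorn_bigcup _ P.
  move=> F FP Ftot.
  have [[X1 FX1 lX1]|no] := pselect (exists2 X, F X & lin X); last first.
    left; apply/seteqP; split=> // x [X FX Xx].
    by have [X0|lX] := FP X FX; [rewrite X0 in Xx|case: no; exists X].
  have linF X x : F X -> X x -> lin X.
    by move=> FX Xx; have [X0|//] := FP X FX; rewrite X0 in Xx.
  right; split.
  - by move=> x Gx; exists X1 => //; case: lX1 => + _ _; exact.
  - move=> a x y [X FX Xx] [Y FY Yy]; have [XY|YX] := Ftot X Y FX FY.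
      have [_ YD _] := linF Y y FY Yy.
      by exists Y => //; apply: YD => //; exact: XY.
    have [_ XD _] := linF X x FX Xx.
    by exists X => //; apply: XD => //; exact: YX.
  - by move=> k [X FX Xk]; have [_ _] := linF X _ FX Xk; exact.
have [GX XD X0] : lin X.
  have [X0|//] := PX; case: (Xmax G); last by right.
  by rewrite X0; split=> // /(_ (0, 0)) h; apply: h; exact: submod_pred0.
have X00 : X (0, 0) by exact/GX/submod_pred0.
have XN x : X x -> X (- x).
  by move=> Xx; rewrite -scaleN1r -[_ *: _]addr0; exact: XD.
have Xfun w k k' : X (w, k) -> X (w, k') -> k = k'.
  move=> Xk /XN Xk'; apply/eqP; rewrite -subr_eq0; apply/eqP/X0.
  have := XD 1 _ _ Xk Xk'; rewrite scale1r.
  by rewrite /GRing.add /= /add_pair /= subrr.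
have [tot|/existsNP[w0 now]] := pselect (forall w, exists k, X (w, k)).
  have /choice[phi phiP] := tot.
  exists phi; split=> [a u v|w k /GX]; last exact: Xfun.
  by apply: Xfun (phiP _) _; exact: XD (phiP u) (phiP v).
(* Y extends X by the value 0 at w0. *)
pose Y : set (W * K^o) := [set x | exists a, X (x.1 - a *: w0, x.2)].
exfalso; apply: (Xmax Y).
  split=> [[w k] Xw|YX]; first by exists 0; rewrite scale0r subr0.
  by apply: now; exists 0; apply: YX; exists 1; rewrite /= scale1r subrr.
right; split.
- by move=> [w k] /GX Xw; exists 0; rewrite scale0r subr0.
- move=> a x y [b Xx] [c Xy]; exists (a * b + c).
  have := XD a _ _ Xx Xy; congr X; congr (_, _) => /=.
  by rewrite scalerBr scalerA scalerDl opprD addrACA.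
- move=> k [a /= Xa]; have [a0|a0] := eqVneq a 0.
    by apply: X0; move: Xa; rewrite a0 scale0r subr0.
  case: now; exists (- (a^-1 * k)).
  have := XD (- a^-1) _ _ Xa X00; congr X; congr (_, _) => /=.
    by rewrite addr0 sub0r scalerN scaleNr opprK scalerA mulVf ?scale1r.
  by rewrite addr0 /GRing.scale /= mulNr.
Qed.

(** The relation that sends s + a w0 to a, for s in S, is single-valued. *)
Lemma separation (S : submod W) w0 : ~ S w0 ->
  exists phi : W -> K^o, [/\ linear phi, forall x, S x -> phi x = 0 & phi w0 = 1].
Proof.
move=> nS.
pose G0 (x : W * K^o) := S (x.1 - x.2 *: w0).
have G00 : G0 0 by rewrite /G0 /= scale0r subr0; exact: submod_pred0.
have GD a u v : G0 u -> G0 v -> G0 (a *: u + v).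
  move=> Gu Gv; have := submod_predD a Gu Gv; congr (submod_pred S _) => /=.
  by rewrite scalerBr scalerA scalerDl opprD addrACA.
have [|phi [lphi phiP]] := @functional_extension (Submod G00 GD).
  rewrite /G0 /= => k; rewrite sub0r => Sk; apply/eqP/negP => /negP k0; apply: nS.
  have := submod_predD (- k^-1) Sk (submod_pred0 S); congr (submod_pred S _).
  by rewrite addr0 scalerN scaleNr opprK scalerA mulVf ?scale1r.
exists phi; split=> // [x Sx|]; apply: phiP; rewrite /= /G0 /=.
  by rewrite scale0r subr0.
by rewrite scale1r subrr; exact: submod_pred0.
Qed.

Definition independent (I : eqType) (e : I -> W) :=
  forall (s : seq I) (a : I -> K), uniq s -> \sum_(i <- s) a i *: e i = 0 ->
    forall i, i \in s -> a i = 0.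

Definition free_set (E : set W) :=
  forall (s : seq W) (a : W -> K), uniq s -> entries_in E s ->
    \sum_(x <- s) a x *: x = 0 -> forall x, x \in s -> a x = 0.

(** A basis of S; it is obtained as a maximal free subset. *)
Lemma maximal_free_set (S : submod W) : exists E : set W,
  [/\ E `<=` S, free_set E & forall w, S w -> in_span E w].
Proof.
pose P E := E `<=` S /\ free_set E.
have [|E [[ES fE] Emax]] := @Zorn_bigcup _ P.
  move=> F FP Ftot; split=> [x [X FX Xx]|].
    by have [+ _] := FP X FX; exact.
  move=> [//|x s] a us ov.
  have [X0 FX0 _] := ov x (mem_head _ _).
  have [X FX Xs] := entries_in_chain FX0 Ftot ov.
  by have [_] := FP X FX; exact.
exists E; split=> // w Sw; apply: contrapT => nw.
apply: (Emax (E `|` [set w])).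
  split; first by move=> x; left.
  by move=> /(_ w (or_intror erefl)) /in_span_gen.
split; first by move=> x [/ES//|->].
move=> s a us ov s0.
have ovr x : x \in s -> x != w -> E x.
  by move=> /ov[//|->]; rewrite eqxx.
have [ws|ws] := boolP (w \in s); last first.
  apply: fE s0 => // x xs; apply: ovr => //.
  by apply: contraNneq ws => <-.
have ovR : entries_in E (rem w s).
  by move=> x; rewrite (rem_filter w us) mem_filter /= => /andP[xw xs]; exact: ovr.
move: s0; rewrite (big_rem w ws) /= => s0.
have aw : a w = 0.
  apply/eqP/negP => /negP aw; apply: nw.
  have -> : w = \sum_(x <- rem w s) (- (a w)^-1 * a x) *: x.
    under eq_bigr do rewrite -scalerA.
    rewrite -scaler_sumr; move/eqP: s0; rewrite addrC addr_eq0 => /eqP ->.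
    by rewrite scaleNr scalerN opprK scalerA mulVf ?scale1r.
  by apply: (@in_span_sum _ _ _ _ _ _ id) => x /ovR; exact: in_span_gen.
move: s0; rewrite aw scale0r add0r => s0 x xs.
have [->//|xw] := eqVneq x w.
apply: (fE _ _ (rem_uniq w us) ovR s0).
by rewrite (rem_filter w us) mem_filter /= xw.
Qed.

Lemma free_set_independent (E : set W) : free_set E ->
  independent (fun x : set_type E => \val x).
Proof.
move=> fE s a us s0 i si.
pose b (x : W) := if (insub x : option (set_type E)) is Some j then a j else 0.
have bE j : b (\val j) = a j by rewrite /b valK.
rewrite -bE; apply: (fE (map val s) b).
- by rewrite (map_inj_uniq val_inj).
- by move=> _ /mapP[j _ ->]; exact/set_mem/valP.
- by rewrite big_map -[RHS]s0; apply: eq_bigr => j _; rewrite bE.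
- exact: map_f.
Qed.

(** A vector in the span of an independent family determines its coefficients,
    so that prescribing the values gives a single-valued relation. *)
Lemma independent_values (I : eqType) (e : I -> W) (t : I -> K) :
  independent e ->
  exists phi : W -> K^o, linear phi /\ forall i, phi (e i) = t i.
Proof.
move=> ind.
pose gen (x : W * K^o) := exists i, x = (e i, t i).
have comb x : in_span gen x -> exists (s : seq I) (a : I -> K), uniq s /\
    x = (\sum_(i <- s) a i *: e i, \sum_(i <- s) a i * t i).
  elim=> [|c _ y [i ->] _ [s [a [us ->]]]].
    by exists [::], (fun=> 0); rewrite !big_nil.
  have [si|nsi] := boolP (i \in s).
    exists s, (fun j => (if j == i then c else 0) + a j); split=> //.
    congr (_, _) => /=.
      under [RHS]eq_bigr do rewrite scalerDl.
      rewrite big_split /=; congr (_ + _).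
      by rewrite (bigD1_seq i) //= eqxx big1 ?addr0 // => j /negPf ->; rewrite scale0r.
    under [RHS]eq_bigr do rewrite mulrDl.
    rewrite big_split /=; congr (_ + _).
    by rewrite (bigD1_seq i) //= eqxx big1 ?addr0 // => j /negPf ->; rewrite mul0r.
  exists (i :: s), (fun j => if j == i then c else a j); split=> /=.
    by rewrite nsi.
  rewrite !big_cons eqxx; congr (_, _); rewrite /=; congr (_ + _);
    apply: eq_big_seq => j js; case: eqP => // ji; by rewrite -ji js in nsi.
have [|phi [lphi phiP]] := @functional_extension (Defs.span gen).
  move=> k /comb[s [a [us [s0 ->]]]]; rewrite big_seq big1 // => i si.
  by rewrite (ind s a us _ i si) ?mul0r.
exists phi; split=> // i; apply: phiP; apply: in_span_gen.
by exists i.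
Qed.

End LinearAlgebra.

(** * Independence of characters *)

Section Characters.
Variables (K : fieldType) (I : choiceType).

(** Dedekind's argument.  Each c extends to a multiplicative function on the
    monoid of words.  Subtracting c0(i) times a linear relation from the relation
    shifted by the letter i removes c0, and it multiplies the coefficient of c by
    c(i) - c0(i), which is nonzero for some i. *)
Lemma characters_independent (s : seq (I -> K)) (a : (I -> K) -> K) :
  uniq s ->
  (forall m : seq I, \sum_(c <- s) a c * \prod_(i <- m) c i = 0) ->
  forall c, c \in s -> a c = 0.
Proof.
elim: s a => [//|c0 s IH] a /= /andP[c0s us] h.
have as0 c : c \in s -> a c = 0.
  move=> cs; have /existsNP[i ne] : ~ forall i, c i = c0 i.
    by move=> /funext e; move: c0s; rewrite -e cs.
  have : a c * (c i - c0 i) = 0.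
    apply: (IH (fun c => a c * (c i - c0 i)) us _ c cs) => m.
    transitivity (\sum_(c <- c0 :: s) a c * \prod_(j <- i :: m) c j -
        c0 i * \sum_(c <- c0 :: s) a c * \prod_(j <- m) c j).
      rewrite mulr_sumr -sumrB [RHS]big_cons big_cons mulrCA subrr add0r.
      apply: eq_bigr => c' _; rewrite big_cons mulrBr mulrBl -!mulrA.
      by congr (_ - _); rewrite mulrCA.
    by rewrite !h mulr0 subr0.
  by move/eqP; rewrite mulf_eq0 subr_eq0 => /orP[/eqP//|/eqP].
move=> c; rewrite inE => /predU1P[->|/as0//].
have := h [::]; rewrite big_cons big_nil mulr1 big_seq big1 ?addr0 // => c' cs.
by rewrite as0 ?mul0r.
Qed.

(** An infinite-dimensional space has at least as many independent functionals
    as there are functions on an infinite independent family d: index the words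
    by the family itself, and let the functional of c take at the vector indexed
    by a word the value of the character of c at that word. *)
Lemma many_functionals (T : lmodType K) (d : I -> T) :
  infinite_set [set: I] -> independent d ->
  exists xi : (I -> K) -> T -> K^o, (forall c, linear (xi c)) /\
    forall (s : seq (I -> K)) (a : (I -> K) -> K), uniq s ->
      (forall i, \sum_(c <- s) a c * xi c (d i) = 0) ->
      forall c, c \in s -> a c = 0.
Proof.
move=> /words_injection[code codeI] ind.
have /choice[word wordP] : forall i, exists m, forall m', code m' = i -> m = m'.
  move=> i; have [[m mi]|no] := pselect (exists m, code m = i).
    by exists m => m' m'i; apply: codeI; rewrite mi.
  by exists [::] => m' m'i; case: no; exists m'.
have /choice[xi xiP] : forall c : I -> K, exists phi : T -> K^o,
    linear phi /\ forall i, phi (d i) = \prod_(j <- word i) c j.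
  by move=> c; exact: independent_values ind.
exists xi; split=> [c|s a us h]; first by have [] := xiP c.
apply: characters_independent us _ => m.
rewrite -[RHS](h (code m)); apply: eq_bigr => c _.
by rewrite (xiP c).2 (wordP _ m).
Qed.

End Characters.

(** * Weight spaces and their iterated duals *)

(* Simplification would otherwise replace the numeric structure [Cx R] by the
   bare type of complex numbers, on which no canonical structure is found. *)
Local Opaque Cx.

Section WeightSpaces.
Variables (R : realType) (V : voa R).
Local Notation C := (Cx R).
Implicit Types W : gmod V.

Definition of_weight W (n : C) (w : W) := gproj W n w = w.

Lemma of_weight_proj W n (w : W) : of_weight n (gproj W n w).
Proof. by have [_ pp _ _] := gproj_grading W; rewrite /of_weight pp eqxx. Qed.

Lemma of_weight0 W n : of_weight n (0 : W).
Proof. by have [lp _ _ _] := gproj_grading W; exact: (linear_0 (lp n)). Qed.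

Lemma of_weightD W n a (u v : W) :
  of_weight n u -> of_weight n v -> of_weight n (a *: u + v).
Proof.
by have [lp _ _ _] := gproj_grading W; rewrite /of_weight (lp n a) => -> ->.
Qed.

Definition weight_space W n := Submod (of_weight0 W n) (@of_weightD W n).

Lemma gdual_of_weight W n (t : gdual (gproj W)) (w : W) :
  of_weight (W := contragredient W) n t -> t (gproj W n w) = t w.
Proof. by move=> {2}<-. Qed.

(** Every functional on W, not only those of the graded dual, has a weight
    component, and this component lies in the graded dual. *)
Lemma weight_functional W n (phi : W -> C^o) : linear phi ->
  exists t : gdual (gproj W), of_weight (W := contragredient W) n t /\
    forall w, t w = phi (gproj W n w).
Proof.
move=> lphi; have [lp pp _ _] := gproj_grading W.
have h : in_gdual (gproj W) (fun w => phi (gproj W n w)).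
  split; first by move=> a u v; rewrite /= (lp n a) lphi.
  apply: (sub_finite_set (B := [set n])); last exact: finite_set1.
  move=> m /= [w]; rewrite pp; case: (n =P m) => [->//|_].
  by rewrite (linear_0 lphi) eqxx.
exists (to_subspace (S := gdual_submod (gproj W)) h); split=> //.
apply: gdualP => w.
by change (phi (gproj W n (gproj W n w)) = phi (gproj W n w)); rewrite pp eqxx.
Qed.

Lemma scalar_comb (K : pzRingType) (U : lmodType K) (phi : U -> K) (I : Type)
    (s : seq I) (a : I -> K) (F : I -> U) :
  scalar phi -> phi (\sum_(i <- s) a i *: F i) = \sum_(i <- s) a i * phi (F i).
Proof.
move=> lphi; elim: s => [|i s IH]; last by rewrite !big_cons lphi IH.
by rewrite !big_nil; exact: (linear_0 (W' := K^o) lphi).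
Qed.

Lemma gdual_seq W (I : Type) (s : seq I) (a : I -> C)
    (F : I -> gdual (gproj W)) w :
  gdual_fun (\sum_(i <- s) a i *: F i) w = \sum_(i <- s) a i * F i w.
Proof. by rewrite gdual_sum. Qed.

(** Here g is an arbitrary map.  If a basis E of the weight space were
    infinite, its dual family would be independent in W', so [many_functionals]
    would give independent elements [eta c] of W'' indexed by all functions c on
    E, that is, by all elements x of weight n of W'.  A functional on W'' whose
    value at the element indexed by x is 1 + g(x)(eta x) differs from every
    g(x).  The conclusion is stated with the coordinate functionals of a basis,
    because this is the form in which finiteness is used. *)
Lemma finite_weight_space W (n : C)
    (g : contragredient W ->
         contragredient (contragredient (contragredient W))) :
  (forall Psi, of_weight n Psi -> exists2 x, of_weight n x & g x = Psi) ->
  exists (s : seq W) (delta : W -> W -> C), (forall e, scalar (delta e)) /\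
    forall w, of_weight n w -> w = \sum_(e <- s) delta e w *: e.
Proof.
move=> gsurj.
have [E [EW freeE spanE]] := maximal_free_set (weight_space W n).
have indE := free_set_independent freeE.
have /choice[delta deltaP] : forall e : W, exists phi : W -> C,
    scalar phi /\ forall i : set_type E, phi (\val i) = (\val i == e)%:R.
  by move=> e; exact: independent_values indE.
have [/finite_seqP[s0 Es]|infE] := pselect (finite_set E).
  exists (undup s0), delta; split=> [e|w /spanE]; first by case: (deltaP e).
  elim=> [|a x y Ex _ IH].
    by rewrite big1 // => e _; rewrite (linear_0 (W' := C^o) (deltaP e).1) scale0r.
  under eq_bigr => e _ do rewrite (deltaP e).1 scalerDl.
  rewrite big_split /= -IH; congr (_ + _).
  have xs : x \in undup s0 by rewrite mem_undup; move: Ex; rewrite Es.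
  have xE e : delta e x = (x == e)%:R.
    exact: (deltaP e).2 (exist _ x (mem_set Ex)).
  rewrite (bigD1_seq x) ?undup_uniq //= xE eqxx mulr1 big1 ?addr0 // => e ne.
  by rewrite xE eq_sym (negPf ne) mulr0 scale0r.
exfalso.
have iw (i : set_type E) : gproj W n (\val i) = \val i.
  by apply/EW/set_mem/valP.
have /choice[d dP] : forall i : set_type E, exists t : gdual (gproj W),
    of_weight (W := contragredient W) n t /\
    forall w, t w = delta (\val i) (gproj W n w).
  by move=> i; apply: weight_functional; case: (deltaP (\val i)).
have dE i j : d i (\val j) = (j == i)%:R.
  by rewrite (dP i).2 iw (deltaP _).2.
have indd : independent (W := contragredient W) d.
  move=> s a us s0 i si.
  have := congr1 (fun t : gdual (gproj W) => t (\val i)) s0.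
  rewrite /= gdual_seq (bigD1_seq i) //= dE eqxx mulr1 big1 ?addr0 // => j ne.
  by rewrite dE eq_sym (negPf ne) mulr0.
have infI : infinite_set [set: set_type E].
  by move=> fE; apply: infE; rewrite -(eq_finite_set (card_setT E)).
have [xi [lxi xiP]] := many_functionals infI indd.
have /choice[eta etaP] : forall c : set_type E -> C,
    exists t : gdual (gproj (contragredient W)),
    of_weight (W := contragredient (contragredient W)) n t /\
    forall w, t w = xi c (gproj (contragredient W) n w).
  by move=> c; exact: weight_functional.
have indeta : independent (W := contragredient (contragredient W)) eta.
  move=> s a us s0; apply: xiP us _ => i.
  rewrite -[RHS]/(gdual_fun (0 : gdual (gproj (contragredient W))) (d i)) -s0.
  rewrite gdual_seq; apply: eq_bigr => c _.
  by rewrite (etaP c).2 (dP i).1.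
have /choice[x xP] : forall c : set_type E -> C, exists t : gdual (gproj W),
    of_weight (W := contragredient W) n t /\ forall i, t (\val i) = c i.
  move=> c; have [phi [lphi phiE]] := independent_values c indE.
  have [t [tn tE]] := weight_functional n lphi.
  by exists t; split=> // i; rewrite tE iw phiE.
(* The diagonal choice. *)
pose r c := 1 + gdual_fun (g (x c)) (eta c).
have [Psi0 [lPsi0 Psi0E]] := independent_values r indeta.
have [Psi [Psin PsiE]] := weight_functional n lPsi0.
have [y yn gy] := gsurj Psi Psin.
pose c (i : set_type E) := gdual_fun (y : gdual (gproj W)) (\val i).
have xy : x c = y.
  apply: gdualP => w; rewrite -(gdual_of_weight _ (xP c).1) -(gdual_of_weight _ yn).
  elim: (spanE _ (of_weight_proj n w)) => [|a u v Eu _ IH].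
    by rewrite !gdual0.
  rewrite !(gdual_linear _ a) IH; congr (_ * _ + _).
  exact: (xP c).2 (exist _ u (mem_set Eu)).
have := PsiE (eta c); rewrite (etaP c).1 Psi0E /r xy gy => /eqP.
by rewrite -subr_eq subrr eq_sym oner_eq0.
Qed.

(** In finite dimension every functional phi on the dual of the weight space is
    the evaluation at a vector, namely at the sum of phi(d_e) e over a basis e
    with dual basis d_e.  If Sp were not everything, some phi <> 0 would vanish
    on Sp, and so would the vector at which phi evaluates, by hypothesis. *)
Lemma separating_span W n (s : seq W) (delta : W -> W -> C)
    (Sp : submod (contragredient W)) :
  (forall e, scalar (delta e)) ->
  (forall w, of_weight n w -> w = \sum_(e <- s) delta e w *: e) ->
  (forall w, of_weight n w ->
     (forall t, Sp t -> of_weight n t -> gdual_fun t w = 0) -> w = 0) ->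
  forall t, of_weight n t -> Sp t.
Proof.
move=> ldelta base sep t tn; apply: contrapT => /separation[phi [lphi phi0 phi1]].
have /choice[d dP] : forall e : W, exists t : gdual (gproj W),
    of_weight (W := contragredient W) n t /\
    forall w, t w = delta e (gproj W n w).
  by move=> e; exact: weight_functional.
pose w := gproj W n (\sum_(e <- s) (phi (d e) : C) *: e).
have phiE u : of_weight n u -> phi u = gdual_fun u w.
  move=> un; pose u' : gdual (gproj W) := u; rewrite -/u'.
  have lu := gdual_linear u'.
  rewrite (gdual_of_weight _ un) (scalar_comb _ _ _ lu).
  transitivity (phi (\sum_(e <- s) u' e *: d e)).
    congr phi; apply: gdualP => v; rewrite gdual_seq -(gdual_of_weight v un).
    rewrite {1}[gproj W n v]base ?(scalar_comb _ _ _ lu); last exact: of_weight_proj.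
    by apply: eq_bigr => e _; rewrite (dP e).2 mulrC.
  by rewrite (scalar_comb _ _ _ lphi); apply: eq_bigr => e _; rewrite mulrC.
have w0 : w = 0.
  apply: sep => [|u Su un]; first exact: of_weight_proj.
  by rewrite -phiE // phi0.
have := phiE t tn; rewrite phi1 w0 gdual0 => /eqP; rewrite oner_eq0.
by [].
Qed.

End WeightSpaces.

(** * The operator L(0) on double contragredients *)

Section Conformal.
Variables (R : realType) (V : voa R).
Local Notation C := (Cx R).
Local Notation conf := (conf V).

(** As the conformal vector is L(-2) applied to the vacuum, the Virasoro
    relations compute L(0) and L(1) on it. *)
Lemma L0_conf : vmode conf 1 conf = 2%:~R *: conf.
Proof.
have [c1 c0] := vmode_creation conf.
have := @virasoro R V 0 (- (2 : int)) (vac V).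
have -> : vmode conf (- (2 : int) + 1) (vac V) = conf by exact: c1.
rewrite add0r c0 // (linear_0 (vmode_linearr conf _)) subr0 => ->.
by rewrite addr0 sub0r opprK.
Qed.

Lemma L1_conf : vmode conf 2 conf = 0.
Proof.
have [c1 c0] := vmode_creation conf.
have := @virasoro R V 1 (- (2 : int)) (vac V).
have -> : vmode conf (- (2 : int) + 1) (vac V) = conf by exact: c1.
rewrite c0 // [vmode conf (1 + - _ + 1) _]c0 // (linear_0 (vmode_linearr conf _)).
rewrite scaler0 subr0 addr0 => e.
by rewrite -[RHS]e.
Qed.

Lemma vproj_conf m : vproj m conf = if m == 2 then conf else 0.
Proof.
have [lp pp _ vE] := vproj_grading V.
have z i : i != 2 -> vproj i conf = 0.
  move=> ne; have := vproj_L0_comm i conf; rewrite L0_conf (linear_Z _ _ (lp i)).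
  move/eqP; rewrite -subr_eq0 -scalerBl scaler_eq0 -intrB intr_eq0 subr_eq0.
  by rewrite eq_sym (negPf ne) /= => /eqP.
case: eqP => [->|/eqP/z//].
rewrite [RHS](vE conf) (fsum_widen (A := [set 2])) ?finite_set1 //.
  by rewrite fset_set1 big_seq_fset1.
by move=> i /= /eqP; exact: z.
Qed.

Lemma L1pow_conf j : (0 < j)%N -> L1pow j conf = 0.
Proof.
case: j => // j _; rewrite /L1pow iterSr L1_conf.
exact: (linear_0 (L1pow_linear j)).
Qed.

Implicit Types W : gmod V.

Definition L0 W : W -> W := gvop W conf 1 0%N.

Lemma L0_linear W : linear (@L0 W).
Proof. exact: gvop_linearr. Qed.

(** The conformal vector has weight 2 and is annihilated by L(1), so a single
    term remains in the formula for the contragredient action, and the sign and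
    the shift of the index cancel. *)
Lemma contra_L0 W (phi : gdual (gproj W)) (w : W) :
  gdual_fun (@L0 (contragredient W) phi) w = phi (@L0 W w).
Proof.
change (phi (contra_op conf 1 0 w) = phi (@L0 W w)); congr (gdual_fun phi _).
rewrite (contra_opE (A := [set (2 : int, 0%N)])) ?finite_set1 //; last first.
  move=> -[m j] /=; rewrite /L1supp /= vproj_conf; case: (m =P 2) => [->|_].
    by case: j => // j; rewrite L1pow_conf ?eqxx.
  by rewrite (linear_0 (L1pow_linear j)) eqxx.
rewrite fset_set1 big_seq_fset1 /contra_term /= vproj_conf eqxx.
rewrite mulr1 fact0 divr1 -exprnP sqrrN expr1n scale1r /L0.
congr (gvop _ _ _ _ _).
by rewrite mulr2n rmorphD /=; ring.
Qed.

Lemma L0_weight W n (w : W) : gproj W n (L0 w) = L0 (gproj W n w).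
Proof.
have [lp pp _ _] := gproj_grading W.
apply: (grading_ext (gproj_grading W) (f := fun w => gproj W n (L0 w))
  (h := fun w => L0 (gproj W n w))).
- by move=> a u v /=; rewrite (L0_linear a) (lp n a).
- by move=> a u v /=; rewrite (lp n a) (L0_linear a).
move=> i u /=.
have L0i : gproj W i (L0 (gproj W i u)) = L0 (gproj W i u).
  have := gvop_weight W 2 1 0%N i conf u; rewrite vproj_conf eqxx.
  have -> : 2%:~R - 1 - 1 + i = i by ring.
  by [].
rewrite pp; case: (n =P i) => [->//|/eqP/negPf ne].
by rewrite -L0i pp ne (linear_0 (@L0_linear W)).
Qed.

Definition L0_shift W (m : C) (w : W) : W := L0 w - m *: w.

Lemma L0_shift_linear W m : linear (@L0_shift W m).
Proof.
move=> a u v; rewrite /L0_shift (L0_linear a) scalerDr !scalerA opprD addrACA.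
by rewrite scalerBr scalerA (mulrC m).
Qed.

Lemma L0_shift_weight W n m (w : W) :
  gproj W n (L0_shift m w) = L0_shift m (gproj W n w).
Proof.
have [lp _ _ _] := gproj_grading W.
rewrite /L0_shift -scaleNr addrC (lp n) L0_weight addrC.
by rewrite scaleNr.
Qed.

Lemma contra_L0_shift W m (phi : gdual (gproj W)) (w : W) :
  gdual_fun (@L0_shift (contragredient W) m phi) w = phi (L0_shift m w).
Proof.
have lphi := gdual_linear phi.
rewrite /L0_shift -[in RHS]scaleNr addrC [in RHS]addrC lphi -contra_L0.
by rewrite -scaleNr; exact: gdual_lin.
Qed.

Definition L0_injective W (q m : C) :=
  forall w : W, of_weight q w -> L0_shift m w = 0 -> w = 0.

(** A vector in the kernel of L(0) - m is an eigenvector of L(0) - q with the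
    eigenvalue m - q, which is nonzero and hence not nilpotent. *)
Lemma nilpotent_injective W q m : q != m ->
  (forall w : W, of_weight q w -> exists K, iter K (L0_shift q) w = 0) ->
  L0_injective W q m.
Proof.
move=> ne nil w qw /eqP; rewrite subr_eq0 => /eqP Lw.
have [K] := nil w qw.
have -> : iter K (L0_shift q) w = (m - q) ^+ K *: w.
  elim: K => [|K IH]; first by rewrite scale1r.
  rewrite iterS IH (linear_Z _ _ (@L0_shift_linear W q)) /L0_shift Lw -scalerBl.
  by rewrite scalerA exprSr.
move/eqP; rewrite scaler_eq0 => /orP[|/eqP//].
by rewrite expf_eq0 subr_eq0 eq_sym (negPf ne) andbF.
Qed.

(** The transpose of an injective map is surjective: the value of tau1 is
    prescribed on the image of L(0) - m. *)
Lemma contra_L0_surjective W q m : L0_injective W q m ->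
  forall tau : contragredient W, of_weight q tau ->
  exists tau1 : contragredient W, L0_shift m tau1 = tau.
Proof.
move=> inj tau0; pose tau : gdual (gproj W) := tau0; rewrite -/tau => tauq.
have [lp pp _ _] := gproj_grading W; have ltau := gdual_linear tau.
have lL := @L0_shift_linear W m.
pose G (x : W * C^o) := exists w, [/\ of_weight q w, x.1 = L0_shift m w & x.2 = tau w].
have G0 : G 0.
  exists 0; split; [exact: (linear_0 (lp q))|by rewrite (linear_0 lL)|].
  by rewrite gdual0.
have GD a x y : G x -> G y -> G (a *: x + y).
  move=> [u [uq u1 u2]] [v [vq v1 v2]]; exists (a *: u + v); split.
  - exact: of_weightD.
  - by rewrite (lL a) /= u1 v1.
  - by rewrite ltau /= u2 v2.
have [|phi [lphi phiE]] := @functional_extension _ _ (Submod G0 GD).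
  move=> k [w [wq /= /esym w0 ->]].
  by rewrite (inj w wq w0) gdual0.
have [tau1 [tau1q tau1E]] := weight_functional q lphi.
exists tau1; apply: gdualP => w.
rewrite contra_L0_shift tau1E L0_shift_weight -(gdual_of_weight w tauq).
by apply: phiE; exists (gproj W q w); split=> //; exact: of_weight_proj.
Qed.

(** The transpose of a surjective map is injective.  Injectivity, unlike local
    nilpotency of L(0) - q, thus passes to the double contragredient even if the
    exponents of nilpotency on a weight space are not bounded. *)
Lemma double_contra_L0_injective W q m : L0_injective W q m ->
  L0_injective (contragredient (contragredient W)) q m.
Proof.
move=> inj Phi0; pose Phi : gdual (gproj (contragredient W)) := Phi0.
rewrite -/Phi => Phiq Phi_ker; apply: gdualP => tau.
rewrite -(gdual_of_weight tau Phiq).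
have [tau1 <-] := contra_L0_surjective inj (of_weight_proj q tau).
by rewrite -contra_L0_shift Phi_ker.
Qed.

Lemma iter_L0_shift_weight W n m K (w : W) :
  gproj W n (iter K (L0_shift m) w) = iter K (L0_shift m) (gproj W n w).
Proof. by elim: K => [//|K IH]; rewrite !iterS L0_shift_weight IH. Qed.

Lemma L0_injective_iter W q m K : L0_injective W q m ->
  forall w : W, of_weight q w -> iter K (L0_shift m) w = 0 -> w = 0.
Proof.
move=> inj; elim: K => [//|K IH] w wq; rewrite iterS => /inj h.
by apply: IH => //; apply: h; rewrite /of_weight iter_L0_shift_weight wq.
Qed.

Lemma of_weight_only W n (w : W) :
  (forall q, q != n -> gproj W q w = 0) -> of_weight n w.
Proof.
have [_ _ _ wE] := gproj_grading W => h.
rewrite /of_weight [RHS](wE w) (fsum_widen (A := [set n])) ?finite_set1 //.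
  by rewrite fset_set1 big_seq_fset1.
by move=> i /= /eqP; exact: h.
Qed.

(** Let w have weight n in W.  Its image g(w) under the inverse g of f is killed
    by a power of L(0) - n, which is injective on the weight spaces of W'' for
    the other weights; so g(w) has weight n.  As g preserves weights, so does
    its inverse f. *)
Lemma double_contra_iso_weight W
    (f : contragredient (contragredient W) -> W) :
  (forall n (w : W), of_weight n w -> exists K, iter K (L0_shift n) w = 0) ->
  module_map f -> bijective f ->
  forall n Psi, of_weight n Psi -> of_weight n (f Psi).
Proof.
move=> nil [lf fY] [g fK gK].
have lg : linear g.
  by move=> a u v; rewrite -[LHS]fK -[RHS]fK gK lf !gK.
have gL K m w : g (iter K (L0_shift m) w) = iter K (L0_shift m) (g w).
  elim: K => [//|K IH]; rewrite !iterS -IH; set u := iter K _ _.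
  rewrite -[RHS]fK /L0_shift -[in RHS]scaleNr [in RHS]addrC lf /L0 fY gK.
  by rewrite scaleNr addrC.
have gw n w : of_weight n w -> of_weight n (g w).
  move=> nw; apply: of_weight_only => q ne.
  have [K Kw] := nil n w nw.
  apply: (@L0_injective_iter _ q n K) (of_weight_proj q _) _.
    apply: double_contra_L0_injective; apply: nilpotent_injective ne _.
    exact: nil.
  rewrite -iter_L0_shift_weight -gL Kw (linear_0 lg).
  by have [lp _ _ _] := gproj_grading (contragredient (contragredient W));
    exact: (linear_0 (lp q)).
have [lp pp _ _] := gproj_grading W.
pose W2 := contragredient (contragredient W).
have [lp2 pp2 _ _] := gproj_grading W2.
move=> n Psi Psin.
have gproj_g w : g (gproj W n w) = gproj W2 n (g w).
  apply: (grading_ext (gproj_grading W) (f := fun w => g (gproj W n w))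
    (h := fun w => gproj W2 n (g w))) => {w}.
  - by move=> a u v /=; rewrite (lp n a) lg.
  - by move=> a u v; rewrite lg; exact: lp2.
  move=> i w; have gi : gproj W2 i _ = _ := gw i _ (of_weight_proj i w).
  rewrite pp -gi pp2.
  case: eqP => [->|_]; first by rewrite gw //; exact: of_weight_proj.
  exact: (linear_0 lg).
rewrite /of_weight -[LHS]gK; congr f.
by rewrite gproj_g fK.
Qed.

End Conformal.

(** * The canonical map into the double contragredient *)

Section Cancellation.
Variable K : numFieldType.

(** The coefficient of x^N in e^(-x) e^x. *)
Lemma exp_cancel_coef (N : nat) :
  \sum_(j < N.+1) (-1) ^+ j / (j`!%:R * (N - j)`!%:R) = (N == 0%N)%:R :> K.
Proof.
have fN (m : nat) : m`!%:R != 0 :> K by rewrite pnatr_eq0 -lt0n fact_gt0.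
have -> : (N == 0%N)%:R = (1 - 1) ^+ N / N`!%:R :> K.
  by rewrite subrr expr0n; case: N => [|N] /=; rewrite ?mul0r // fact0 divr1.
rewrite exprBn mulr_suml; apply: eq_bigr => j _.
have jN : (j <= N)%N by rewrite -ltnS.
rewrite !expr1n !mulr1 -(bin_fact jN) !natrM -mulr_natr.
by field; rewrite !fN pnatr_eq0 -lt0n bin_gt0 jN.
Qed.

(** The identity e^(-L) e^L = 1 for a nilpotent operator L, where a(N) stands for
    the value of a linear functional at L^N u. *)
Lemma exp_cancel (J : nat) (a : nat -> K) :
  (forall N, (J <= N)%N -> a N = 0) ->
  \sum_(j < J) \sum_(i < J) (-1) ^+ j / (j`!%:R * i`!%:R) * a (j + i)%N = a 0%N.
Proof.
move=> a0.
transitivity (\sum_(N < J) \sum_(j < J | (j <= N)%N)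
    (-1) ^+ j / (j`!%:R * (N - j)`!%:R) * a N).
  rewrite [RHS](exchange_big_dep xpredT) //=; apply: eq_bigr => j _.
  rewrite -(big_mkord xpredT (fun i => (-1) ^+ j / (j`!%:R * i`!%:R) * a (j + i)%N)).
  rewrite (big_cat_nat (n := (J - j)%N)) ?leq_subr //=.
  rewrite [X in _ + X]big1_seq ?addr0; last first.
    move=> i /andP[_]; rewrite mem_index_iota leq_subLR => /andP[Ji _].
    by rewrite a0 ?mulr0.
  rewrite -(big_mkord (fun N => (j <= N)%N)
     (fun N => (-1) ^+ j / (j`!%:R * (N - j)`!%:R) * a N)).
  rewrite [RHS](big_cat_nat (n := j)) ?(ltnW (ltn_ord j)) //=.
  rewrite [X in _ = X + _]big1_seq ?add0r; last first.
    move=> N /andP[jN]; rewrite mem_index_iota => /andP[_ Nj].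
    by move: jN; rewrite leqNgt Nj.
  transitivity (\sum_(0 + j <= N < J | (j <= N)%N)
      (-1) ^+ j / (j`!%:R * (N - j)`!%:R) * a N); last by rewrite add0n.
  rewrite big_addn [RHS]big_mkcond; apply: eq_bigr => i _.
  by rewrite leq_addl addnK addnC.
transitivity (\sum_(N < J) (N == 0%N :> nat)%:R * a N).
  apply: eq_bigr => N _; rewrite -exp_cancel_coef mulr_suml.
  by rewrite [RHS](big_ord_widen J (fun j : nat =>
    (-1) ^+ j / (j`!%:R * (N - j)`!%:R) * a N) (ltn_ord N)).
case: J a0 => [|J] a0; first by rewrite big_ord0 a0.
rewrite big_ord_recl /= mul1r big1 ?addr0 // => i _.
by rewrite mul0r.
Qed.

End Cancellation.

Section DoubleContragredient.
Variables (R : realType) (V : voa R).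
Local Notation C := (Cx R).
Implicit Types W : gmod V.

Lemma L1pow_vanish (r : int) (v : V) : exists J : nat,
  forall j, (J <= j)%N -> L1pow j (vproj r v) = 0.
Proof.
have [N HN] := vproj_lower V; exists `|r - N|%N.+1 => j lt.
rewrite -vproj_L1pow HN //; rewrite ltrBlDl -ltrBlDr.
by apply: le_lt_trans (ler_norm _) _; rewrite -abszE ltz_nat.
Qed.

(** For v of weight r only the terms (m, j) with m = r are nonzero.  The bound J
    may exceed the number of nonzero terms; this allows the same bound for all
    the vectors L(1)^j v. *)
Lemma contra_op_homogeneous W (r : int) (v : V) (J : nat) n k (w : W) :
  vproj r v = v -> (forall j, (J <= j)%N -> L1pow j v = 0) ->
  contra_op v n k w = \sum_(j < J) ((-1) ^ r * (-1) ^+ k / (j`!)%:R) *: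
    gvop W (L1pow j v) ((r *+ 2)%:~R - j%:R - n - 2%:R) k w.
Proof.
move=> rv J0; have [lp pp _ _] := vproj_grading V.
have vr m : vproj m v = if m == r then v else 0.
  by rewrite -{1}rv pp; case: eqP => [->|].
pose s := map (pair r) (iota 0 J).
have us : uniq s by rewrite map_inj_uniq ?iota_uniq // => i j [].
rewrite (contra_opE (A := [set` s]) n k w (finite_seq s)); last first.
  move=> -[m j]; rewrite /L1supp /= vr; case: (m =P r) => [->|_]; last first.
    by rewrite (linear_0 (L1pow_linear j)) eqxx.
  move=> nz; apply: map_f; rewrite mem_iota add0n /= ltnNge.
  by apply: contraNN nz => /J0 ->.
rewrite (perm_big s); last first.
  apply: uniq_perm (fset_uniq _) us _ => x; rewrite (in_fset_set (finite_seq s)).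
  by rewrite mem_setE.
rewrite /s big_map -{1}(subn0 J) -/(index_iota 0 J) big_mkord.
apply: eq_bigr => j _.
by rewrite /contra_term /= vr eqxx.
Qed.

(** The canonical map from W to W'' commutes with the vertex operators.  For v of
    weight r, applying the contragredient formula twice produces a double sum
    over powers L(1)^j and L(1)^i.  Its signs combine to (-1)^j, because L(1)^j v
    has weight r - j; so e^(L(1)) meets e^(-L(1)) and [exp_cancel] leaves only
    the term with i = j = 0. *)
Lemma double_contra_op W v n k (phi : gdual (gproj W)) (w : W) :
  gdual_fun (contra_op (W := contragredient W) v n k phi) w = phi (gvop W v n k w).
Proof.
have lphi := gdual_linear phi; have [lp pp _ _] := vproj_grading V.
apply: (grading_ext (vproj_grading V) (W' := C^o)
  (f := fun v => gdual_fun (contra_op (W := contragredient W) v n k phi) w)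
  (h := fun v => phi (gvop W v n k w))).
- by move=> a x y; rewrite (contra_op_linearl (W := contragredient W) n k phi a).
- by move=> a x y /=; rewrite (gvop_linearl W n k w a) lphi.
move=> r x; have [J J0] := L1pow_vanish r x; set u := vproj r x in J0 *.
have ru : vproj r u = u by rewrite /u pp eqxx.
rewrite (contra_op_homogeneous (W := contragredient W) n k phi ru J0).
rewrite gdual_seq.
pose a N := phi (gvop W (L1pow N u) (n - N%:R) k w).
have a0 N : (J <= N)%N -> a N = 0.
  by move=> /J0 uN; rewrite /a uN gvop0 gdual0.
transitivity (a 0%N); last by rewrite /a subr0.
rewrite -(exp_cancel a0); apply: eq_bigr => j _.
have rj : vproj (r - j%:Z) (L1pow j u) = L1pow j u.
  by rewrite -ru vproj_L1pow.
have J0j i : (J <= i)%N -> L1pow i (L1pow j u) = 0.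
  move=> Ji; rewrite /L1pow -iterD -/(L1pow (i + j) u) J0 //.
  by rewrite (leq_trans Ji) ?leq_addr.
set nj := (_ - n - 2%:R).
change (gdual_fun _ w) with (phi (contra_op (L1pow j u) nj k w)).
rewrite (contra_op_homogeneous nj k w rj J0j) (scalar_comb _ _ _ lphi) mulr_sumr.
apply: eq_bigr => i _.
rewrite /a; have -> : L1pow i (L1pow j u) = L1pow (j + i) u.
  by rewrite /L1pow -iterD addnC.
have -> : ((r - j%:Z) *+ 2)%:~R - i%:R - nj - 2%:R = n - (j + i)%:R :> C.
  by rewrite /nj !mulr2n !rmorphD /= !rmorphN /= -pmulrn; ring.
rewrite mulrA; congr (_ * _).
have rr : (-1) ^ r * (-1) ^ r = 1 :> C by rewrite -expfzMl mulrNN mulr1 exp1rz.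
have kk : (-1) ^+ k * (-1) ^+ k = 1 :> C by rewrite -exprMn mulrNN mulr1 expr1n.
rewrite expfzDr ?oppr_eq0 ?oner_eq0 // -exprnN invr_sign invfM.
move: rr kk; move: ((-1) ^ r) ((-1) ^+ k) => s1 s2 rr kk.
set x1 := (_^-1); set x2 := (_^-1).
transitivity ((s1 * s1) * (s2 * s2) * ((-1) ^+ j * (x1 * x2))); first by ring.
by rewrite rr kk !mul1r.
Qed.

End DoubleContragredient.

(** * Products and the box space *)

Section Completion.
Variables (R : realType) (V : voa R) (W : gmod V).
Local Notation C := (Cx R).

(** Holds without any convergence, as the sum defining a component has finite
    support or is zero. *)
Lemma eval_bar_weight (c : C -> nat -> W) p z n :
  of_weight n (eval_bar c p z n).
Proof.
have [lp pp _ _] := gproj_grading W.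
rewrite /of_weight /eval_bar (linear_seq _ _ (lp n)).
by apply: eq_bigr => mk _; rewrite (linear_Z _ _ (lp n)) pp eqxx.
Qed.

Lemma pair_barE (phi : gdual (gproj W)) (x : C -> W) (A : set C) :
  (forall n, of_weight n (x n)) -> finite_set A ->
  (forall n, ~ A n -> forall w, phi (gproj W n w) = 0) ->
  pair_bar phi x = \sum_(n <- fset_set A) phi (x n).
Proof.
move=> xw fA A0; apply: (fsum_widen (W := C^o) fA) => n nA.
by rewrite -(xw n) A0.
Qed.

Lemma pair_bar_linear a (phi psi : gdual (gproj W)) (x : C -> W) :
  (forall n, of_weight n (x n)) ->
  pair_bar (a *: phi + psi) x = a * pair_bar phi x + pair_bar psi x.
Proof.
move=> xw; have [_ f1] := subspaceP phi; have [_ f2] := subspaceP psi.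
set A1 := [set n | _] in f1; set A2 := [set n | _] in f2.
have fA : finite_set (A1 `|` A2) by rewrite finite_setU.
have phi0 n : ~ (A1 `|` A2) n -> forall w, phi (gproj W n w) = 0.
  move=> nA w; apply: contrapT => /eqP h.
  by apply: nA; left; exists w.
have psi0 n : ~ (A1 `|` A2) n -> forall w, psi (gproj W n w) = 0.
  move=> nA w; apply: contrapT => /eqP h.
  by apply: nA; right; exists w.
rewrite (pair_barE xw fA phi0) (pair_barE xw fA psi0) (pair_barE xw fA); last first.
  by move=> n nA w; rewrite gdual_lin phi0 // psi0 // mulr0 addr0.
by rewrite mulr_sumr -big_split.
Qed.

Lemma pair_bar_proj n (phi : gdual (gproj W)) (x : C -> W) :
  (forall n, of_weight n (x n)) -> pair_bar (contra_proj n phi) x = phi (x n).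
Proof.
have [_ pp _ _] := gproj_grading W => xw.
rewrite (pair_barE xw (finite_set1 n)).
  rewrite fset_set1 big_seq_fset1.
  by change (phi (gproj W n (x n)) = phi (x n)); rewrite xw.
move=> m /= mn w; change (phi (gproj W n (gproj W m w)) = 0).
by rewrite pp; case: (n =P m) => [nm|_]; [case: mn|rewrite gdual0].
Qed.

(** A nonzero vector has a nonzero component, on which some functional does not
    vanish. *)
Lemma gdual_separates (u w : W) :
  (forall phi : gdual (gproj W), phi u = phi w) -> u = w.
Proof.
have [lp pp _ wE] := gproj_grading W => h.
have {}h (phi : gdual (gproj W)) : phi (u - w) = 0.
  by rewrite -scaleN1r addrC (gdual_linear phi) h mulN1r addNr.
apply/eqP; rewrite -subr_eq0; move: (u - w) h => {}u h.
rewrite (wE u) fsbig1 // => n _; apply: contrapT => un.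
have /separation[phi [lphi _ phi1]] :
    ~ Defs.span (fun _ : W => False) (gproj W n u).
  by move=> /= s; apply: un; elim: s.
have [t [_ tE]] := weight_functional n lphi.
by have := h t; rewrite tE phi1 => /eqP; rewrite oner_eq0.
Qed.

End Completion.

Section Universality.
Variables (R : realType) (V : voa R) (G : aut_group V) (z : Cx R).
Variables (Cat : tw_obj G -> Prop) (W1 W2 : tw_obj G).
Variables (S : gstr V (box Cat z W1 W2)).
Variables (act : option (ag_elt G -> box Cat z W1 W2 -> box Cat z W1 W2)).
Local Notation C := (Cx R).
Local Notation B := (GMod S).
Local Notation T := (contragredient B).
Local Notation bx := (@box_map R V G Cat z W1 W2 S act).

Definition is_box_component (t : T) := exists w1 w2 n, t = bx w1 w2 n.

Lemma box_mapE w1 w2 n (l : box Cat z W1 W2) :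
  gdual_fun (bx w1 w2 n : gdual (gproj S)) l = \val (gproj S n l) w1 w2.
Proof. by []. Qed.

(** A component of weight n of the map [bx] evaluates bilinear forms, so the
    components of weight n have no common zero on the weight space B_n, which is
    finite-dimensional by the isomorphism of T'' with T. *)
Lemma box_components_span :
  (forall n (t : T), of_weight n t -> exists K, iter K (L0_shift n) t = 0) ->
  (exists2 f : contragredient (contragredient T) -> T,
     module_map f & bijective f) ->
  forall t : T, in_span is_box_component t.
Proof.
move=> nil [f fY fbij] t; have [_ _ _ tE] := gproj_grading T.
have fw := double_contra_iso_weight nil fY fbij.
have [g fK gK] := fbij.
have span_n n (u : T) : of_weight n u -> in_span is_box_component u.
  have [Psi Psin|s [delta [ldelta base]]] := @finite_weight_space _ _ B n g.
    by exists (f Psi); [exact: fw|exact: fK].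
  move=> un.
  apply: (separating_span (Sp := Defs.span is_box_component) ldelta base _ un).
  move=> l ln sep; apply/val_inj/funext => w1; apply/funext => w2.
  have bn : of_weight n (bx w1 w2 n : T).
    apply: gdualP => l'; change (\val (gproj S n (gproj S n l')) w1 w2 =
      \val (gproj S n l') w1 w2).
    by have := @of_weight_proj _ _ B n l' => /= ->.
  have := sep (bx w1 w2 n) (in_span_gen _) bn.
  rewrite box_mapE (ln : gproj S n l = l) => -> //.
  by exists w1, w2, n.
have [s us ->] := grading_seq (gproj_grading T) t.
under eq_bigr do rewrite -[gproj _ _ _]scale1r.
apply: in_span_sum => n _.
by apply: span_n; exact: of_weight_proj.
Qed.

Section Product.
Variables (W3 : tw_obj G) (I : W1 -> W2 -> C -> W3).
Hypothesis prodI : Pz_product Cat z I.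

Lemma product_weight w1 w2 n : of_weight n (I w1 w2 n).
Proof. by case: prodI => _ _ [Y _ ->]; exact: eval_bar_weight. Qed.

Lemma lambda_in_box (w' : contragredient W3) :
  Defs.span (box_gen Cat z (W1 := W1) (W2 := W2)) (lambda I w').
Proof. by apply: in_span_gen; exists W3, I, w'. Qed.

Definition lambda_box (w' : contragredient W3) : B :=
  to_subspace (S := Defs.span (box_gen Cat z (W1 := W1) (W2 := W2)))
    (lambda_in_box w').

Lemma lambda_box_linear : linear lambda_box.
Proof.
move=> a u v; apply/val_inj/funext => w1; apply/funext => w2.
transitivity (a * pair_bar u (I w1 w2) + pair_bar v (I w1 w2)).
  by apply: pair_bar_linear; exact: product_weight.
by rewrite box_linE.
Qed.

Hypothesis boxS : box_structure S act.

Lemma lambda_box_vop v n k (w' : contragredient W3) :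
  gvop S v n k (lambda_box w') = lambda_box (gvop (contragredient W3) v n k w').
Proof.
apply: val_inj; have [h _] := boxS.
by have [-> _] := h W3 I w' (lambda_box w') prodI erefl.
Qed.

Lemma lambda_box_proj n (w' : contragredient W3) :
  gproj S n (lambda_box w') = lambda_box (gproj (contragredient W3) n w').
Proof.
apply: val_inj; have [h _] := boxS.
by have [_ ->] := h W3 I w' (lambda_box w') prodI erefl.
Qed.

Lemma lambda_box_contra_op v n k (w' : contragredient W3) :
  contra_op (W := B) v n k (lambda_box w') =
  lambda_box (contra_op (W := contragredient W3) v n k w').
Proof.
rewrite !(contra_opE _ _ _ (L1supp_finite v) (@subset_refl _ _)).
rewrite (linear_seq _ _ lambda_box_linear); apply: eq_bigr => mj _.
rewrite /contra_term (linear_Z _ _ lambda_box_linear); congr (_ *: _).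
exact: lambda_box_vop.
Qed.

(** On the components of [bx], the transpose of [lambda_box] is the evaluation at
    the components of I: taking the weight n component of w' in the pairing with
    the completion leaves only the weight n component of I(w1, w2). *)
Lemma box_map_lambda w1 w2 n (w' : contragredient W3) :
  gdual_fun (bx w1 w2 n : gdual (gproj S)) (lambda_box w') =
  gdual_fun (w' : gdual (gproj W3)) (I w1 w2 n).
Proof.
rewrite box_mapE lambda_box_proj; apply: pair_bar_proj => m.
exact: product_weight.
Qed.

(** The transpose of [lambda_box] takes values in W3'', but on the spanning
    elements of T these values are evaluations at vectors of W3. *)
Lemma transpose_exists : (forall t : T, in_span is_box_component t) ->
  exists f : T -> W3, forall (t : T) (w' : contragredient W3),
    gdual_fun (w' : gdual (gproj W3)) (f t) =
    gdual_fun (t : gdual (gproj S)) (lambda_box w').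
Proof.
move=> spanT.
have /choice[f fE] : forall t : T, exists w : W3, forall w' : contragredient W3,
    gdual_fun (w' : gdual (gproj W3)) w =
    gdual_fun (t : gdual (gproj S)) (lambda_box w').
  move=> t; elim: (spanT t) => [|a _ y [w1 [w2 [n ->]]] _ [w wE]].
    by exists 0 => w'; rewrite gdual0.
  exists (a *: I w1 w2 n + w) => w'.
  rewrite (gdual_linear (w' : gdual (gproj W3)) a) wE -box_map_lambda.
  exact: esym (gdual_lin _ _ _ _).
by exists f.
Qed.

Lemma transpose_module_map (f : T -> W3) :
  (forall (t : T) (w' : contragredient W3),
    gdual_fun (w' : gdual (gproj W3)) (f t) =
    gdual_fun (t : gdual (gproj S)) (lambda_box w')) ->
  module_map f /\ forall w1 w2, I w1 w2 = f \o bx w1 w2.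
Proof.
move=> fE; split; first split.
- move=> a t u; apply: gdual_separates => w'.
  rewrite (gdual_linear w' a) !fE; exact: gdual_lin.
- move=> v n k t; apply: gdual_separates => w'.
  rewrite -double_contra_op fE.
  rewrite (fE t (contra_op (W := contragredient W3) v n k w')).
  by rewrite -lambda_box_contra_op.
- move=> w1 w2; apply/funext => n; apply: gdual_separates => w'.
  by rewrite fE box_map_lambda.
Qed.

End Product.
End Universality.

Theorem theorem4p6 (R : realType) (V : voa R) (G : aut_group V) (z : Cx R)
  (Cat : tw_obj G -> Prop)
  (hz : z != 0)
  (hCat : twisted_category Cat)
  (hassumption : tensor_assumption Cat z)
  (W1 W2 : tw_obj G) (hW1 : Cat W1) (hW2 : Cat W2)
  (S : gstr V (box Cat z W1 W2))
  (act : option (ag_elt G -> box Cat z W1 W2 -> box Cat z W1 W2))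
  (hbox : box_structure S act)
  (htensor : Cat (tensor_obj S act))
  (hmap : Pz_intertwining_map z (box_map S act)) :
  Pz_tensor_product Cat z (box_map S act).
Proof.
(* The inverse of the inverse of g1 g2 is convertible to g1 g2. *)
split; first by split.
have [tmod _] : twisted_module (tw_aut (tensor_obj S act)) (tensor_obj S act).
  by case: hCat => /(_ _ htensor)[].
have nilT n (t : contragredient (GMod S)) :
    of_weight n t -> exists K, iter K (L0_shift n) t = 0.
  by move=> /(gtm_L0 tmod)[K [_ KE]]; exists K.
have spanT := box_components_span act nilT (proj2 hassumption _ htensor).
move=> W3 I prodI; have [f fE] := transpose_exists prodI hbox spanT.
have [fY fI] := transpose_module_map hbox fE; have [lf _] := fY.
exists f; split=> // f' [[lf' _] f'I]; apply/funext => t.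
elim: (spanT t) => [|a _ y [w1 [w2 [n ->]]] _ IH].
  by rewrite (linear_0 lf) (linear_0 lf').
rewrite (lf a) (lf' a) IH; congr (_ *: _ + _).
by have := congr1 (fun x => x n) (etrans (esym (fI w1 w2)) (f'I w1 w2)).
Qed.
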